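(* Let $f,g:\mathbb{R}^n\to\mathbb{R}$ be $\mathcal{C}^3$ on $B(x^0;\overline{\Delta})$, where $x^0\in\mathbb{R}^n$ and $\overline{\Delta}>0$. Let $S=[s^1\;\cdots\;s^m]\in\mathbb{R}^{n\times m}$ and $T=[t^1\;\cdots\;t^k]\in\mathbb{R}^{n\times k}$ have full row rank, and assume that the closed ball of centre $x^0+s^i$ and radius $\Delta_T$ is contained in $B(x^0;\overline{\Delta})$ for all $i\in\{1,\dots,m\}$. Then $$\|\nabla^2_{sc}(fg)(x^0;S,T)-\nabla^2(fg)(x^0)\|\le\left(E_{\nabla_s^2 f}|g(x^0)|+E_{\nabla_s^2 g}|f(x^0)|+2M^s_{fg}\right)\Delta_u,$$ where $$M^s_{fg}=\min\left\{\begin{array}{l} E_{\nabla_s f}E_{\nabla_s g}\Delta_u+E_{\nabla_s g}\|\nabla f(x^0)\|+E_{\nabla_s f}\|\nabla g(x^0)\|, \\ E_{\nabla_s f}\|\nabla_s g(x^0;T)\|+E_{\nabla_s g}\|\nabla f(x^0)\|, \\ E_{\nabla_s g}\|\nabla_s f(x^0;T)\|+E_{\nabla_s f}\|\nabla g(x^0)\|\end{array}\right\}.$$ Moreover, if $\mathcal{S}(x^0;S,T)$ is poised for quadratic interpolation, then $$\|\nabla^2_{qc}(fg)(x^0;S,T)-\nabla^2(fg)(x^0)\|\le\left(E_{\nabla_s^2 f}|g(x^0)|+E_{\nabla_s^2 g}|f(x^0)|+2M^q_{fg}\Delta_u\right)\Delta_u,$$ where $$M^q_{fg}=\min\left\{\begin{array}{l}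 E_{\nabla Q_f}E_{\nabla Q_g}\Delta_u^2+E_{\nabla Q_g}\|\nabla f(x^0)\|+E_{\nabla Q_f}\|\nabla g(x^0)\|, \\ E_{\nabla Q_f}\|\nabla Q_g(x^0;S,T)(x^0)\|+E_{\nabla Q_g}\|\nabla f(x^0)\|, \\ E_{\nabla Q_g}\|\nabla Q_f(x^0;S,T)(x^0)\|+E_{\nabla Q_f}\|\nabla g(x^0)\|\end{array}\right\}.$$
   Context: Notation. $B(x^0;\overline{\Delta})$ is the open Euclidean ball; vector norms are Euclidean, matrix norms the induced 2-norm; $\dagger$ is the Moore--Penrose pseudoinverse. $\Delta_S=\max_i\|s^i\|$, $\Delta_T=\max_j\|t^j\|$, $\Delta_u=\max\{\Delta_S,\Delta_T\}$, $\Delta_l=\min\{\Delta_S,\Delta_T\}$, $\widehat{S}=S/\Delta_S$, $\widehat{T}=T/\Delta_T$. For $h\in\{f,g\}$, $L_{\nabla h}$ and $L_{\nabla^2 h}$ denote the Lipschitz constants of $\nabla h$ and $\nabla^2 h$ on $B(x^0;\overline{\Delta})$ (both maps are assumed Lipschitz there). Generalized simplex gradient: $\nabla_s h(x;T)=(T^\top)^\dagger\big(h(x+t^j)-h(x)\big)_{j=1}^k$. Nested-set Hessian: $\nabla_s^2 h(x^0;S,T)=(S^\top)^\dagger\delta_{\nabla_s h}(x^0;S,T)$, where the $i$-th row of $\delta_{\nabla_s h}(x^0;S,T)\in\mathbb{R}^{m\times n}$ is $(\nabla_s h(x^0+s^i;T)-\nabla_s h(x^0;T))^\top$. $\mathcal{S}(x^0;S,T)=\{x^0\}\cup\{x^0+s^i\}_i\cup\{x^0+t^j\}_j\cup\{x^0+s^i+t^j\}_{i,j}$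 is the set of distinct points used in this computation. A set of distinct points $\{y^0,\dots,y^p\}\subset\mathbb{R}^n$ with $p=\frac12(n+1)(n+2)-1$ is poised for quadratic interpolation if the system $\alpha_0+\alpha^\top y^i+\frac12(y^i)^\top\mathbf{H}y^i=0$, $i=0,\dots,p$, has a unique solution $\alpha_0\in\mathbb{R}$, $\alpha\in\mathbb{R}^n$, $\mathbf{H}=\mathbf{H}^\top\in\mathbb{R}^{n\times n}$. When $\mathcal{S}(x^0;S,T)$ is poised for quadratic interpolation, $Q_h(x^0;S,T)$ is the unique quadratic function $x\mapsto\alpha_0+\alpha^\top x+\frac12x^\top\mathbf{H}x$ ($\mathbf{H}$ symmetric) agreeing with $h$ on $\mathcal{S}(x^0;S,T)$, and $\nabla Q_h(x^0;S,T)(x^0)$ is its gradient at $x^0$. Simplex calculus Hessian of the product (with $f,g$ evaluated at $x^0$, simplex gradients at $x^0$ over $T$, nested-set Hessians at $x^0$ over $S,T$): $$\nabla^2_{sc}(fg)(x^0;S,T)=(\nabla_s^2 f)g+\nabla_s f(\nabla_s g)^\top+\nabla_s g(\nabla_s f)^\top+(\nabla_s^2 g)f.$$ Quadratic calculus Hessian of the product (gradients of $Q_f,Q_g$ evaluated at $x^0$): $$\nabla^2_{qc}(fg)(x^0;S,T)=(\nabla_s^2 f)g+\nabla Q_f(\nabla Q_g)^\top+\nabla Q_g(\nabla Q_f)^\top+(\nabla_s^2 g)f.$$ Error constants, for $h\in\{f,g\}$: $$E_{\nabla_s h}=\frac{\sqrt{k}}{2}L_{\nabla h}\left\|(\widehat{T}^\top)^\dagger\right\|,\qquad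 E_{\nabla_s^2 h}=\frac{m\sqrt{k}}{3}L_{\nabla^2 h}\left(2\frac{\Delta_u}{\Delta_l}+3\right)\left\|(\widehat{S}^\top)^\dagger\right\|\left\|\widehat{T}^\dagger\right\|,$$ $$E_{\nabla Q_h}=6(1+\sqrt2)\sqrt{p}\,L_{\nabla^2 h}\left\|\widehat{Q}^{-1}\right\|.$$ Here $p=\frac12(n+1)(n+2)-1$ and, writing $\mathcal{S}(x^0;S,T)=\{y^0=x^0,y^1,\dots,y^p\}$ and $z^i=(y^i-x^0)/(\Delta_S+\Delta_T)$, $\widehat{Q}\in\mathbb{R}^{p\times p}$ is the matrix whose $i$-th row ($i=1,\dots,p$) consists of $z^i_1,\dots,z^i_n$, followed by $\frac12(z^i_1)^2,\dots,\frac12(z^i_n)^2$, followed by the products $z^i_a z^i_b$ for $1\le a<b\le n$; it is invertible when $\mathcal{S}(x^0;S,T)$ is poised for quadratic interpolation. *)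

(* Defs.v *)
From mathcomp Require Import all_boot all_order all_algebra.
From mathcomp Require Import all_classical all_reals all_analysis.
Set Implicit Arguments.
Unset Strict Implicit.
Unset Printing Implicit Defensive.
Import Order.TTheory GRing.Theory Num.Theory.
Import numFieldNormedType.Exports.
Local Open Scope classical_set_scope.
Local Open Scope ring_scope.

(* Points of R^n are column vectors.  The library norm on matrices is the max
   norm; it induces the usual topology, so continuity and derivatives are the
   library's, but every norm in a bound is [enorm] or [opnorm]. *)

Section Norms.
Variable R : realType.

Definition enorm n (x : 'cV[R]_n) : R := Num.sqrt (\sum_i x i 0 ^+ 2).

Definition opnorm m n (A : 'M[R]_(m, n)) : R :=
  sup [set enorm (A *m x) | x in [set x | enorm x <= 1]].

Definition eball n (x : 'cV[R]_n) (r : R) : set 'cV[R]_n :=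
  [set y | enorm (y - x) < r].

Definition eclosed_ball n (x : 'cV[R]_n) (r : R) : set 'cV[R]_n :=
  [set y | enorm (y - x) <= r].

(* The set of values is nonempty and bounded, so [sup] is not a default. *)
Lemma opnorm_has_sup m n (A : 'M[R]_(m, n)) :
  has_sup [set enorm (A *m x) | x in [set x | enorm x <= 1]].
Proof.
have e0 q : enorm (0 : 'cV[R]_q) = 0.
  by rewrite /enorm big1 ?sqrtr0// => i _; rewrite mxE expr0n.
split; first by exists (enorm (A *m 0)), 0 => //=; rewrite e0 ler01.
exists (Num.sqrt (\sum_i (\sum_j `|A i j|) ^+ 2)) => _ [x /= x1 <-].
have xj j : `|x j 0| <= 1.
  apply: le_trans x1; rewrite -sqrtr_sqr; apply: ler_wsqrtr.
  by rewrite (bigD1 j)//= lerDl sumr_ge0// => i _; rewrite sqr_ge0.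
apply: ler_wsqrtr; apply: ler_sum => i _.
rewrite -[leLHS]real_normK ?num_real//.
rewrite ler_sqr ?nnegrE ?sumr_ge0// mxE (le_trans (ler_norm_sum _ _ _))//.
by apply: ler_sum => j _; rewrite normrM ler_piMr.
Qed.

End Norms.

Section PseudoInverse.
Variable R : realType.

Definition moore_penrose m n (A : 'M[R]_(m, n)) (B : 'M[R]_(n, m)) : Prop :=
  [/\ A *m B *m A = A, B *m A *m B = B,
      (A *m B)^T = A *m B & (B *m A)^T = B *m A].

Definition mpinv m n (A : 'M[R]_(m, n)) : 'M[R]_(n, m) :=
  xget 0 [set B | moore_penrose A B].

Lemma moore_penrose_uniq m n (A : 'M[R]_(m, n)) B C :
  moore_penrose A B -> moore_penrose A C -> B = C.
Proof.
move=> [ABA BAB ABt BAt] [ACA CAC ACt CAt].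
have AB_AC : A *m B = A *m C.
  rewrite -ABt -{1}ACA -(mulmxA (A *m C)) trmx_mul ABt ACt.
  by rewrite mulmxA ABA.
have BA_CA : B *m A = C *m A.
  rewrite -BAt -{1}ACA -(mulmxA A) mulmxA trmx_mul BAt CAt.
  by rewrite -mulmxA (mulmxA A) ABA.
by rewrite -BAB BA_CA -mulmxA AB_AC mulmxA CAC.
Qed.

Lemma row_free_gram m n (A : 'M[R]_(m, n)) :
  row_free A -> A *m A^T \in unitmx.
Proof.
move=> Afree; rewrite -row_free_unit -kermx_eq0; apply/rowV0P => v.
move=> /sub_kermxP vAA; apply/eqP; rewrite -(mulmx_free_eq0 _ Afree).
have : (v *m A) *m (v *m A)^T = 0.
  by rewrite trmx_mul mulmxA -(mulmxA v) vAA mul0mx.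
move=> /matrixP/(_ 0 0); rewrite !mxE => /eqP.
rewrite psumr_eq0 => [/allP w0|i _]; last first.
  by rewrite [X in _ * X]mxE -expr2 sqr_ge0.
apply/eqP/rowP => j; have := w0 j (mem_index_enum _).
by rewrite [X in _ * X]mxE mulf_eq0 orbb => /eqP ->; rewrite mxE.
Qed.

Lemma mpinvP m n (A : 'M[R]_(m, n)) : moore_penrose A (mpinv A).
Proof.
rewrite /mpinv; apply: (@xgetPex _ 0 [set B | moore_penrose A B]).
have := mulmx_base A; have := row_base_free A; have := col_base_full A.
move: (\rank A) (col_base A) (row_base A) => r C F Cfull Ffree /esym AE.
have Funit : F *m F^T \in unitmx by exact: row_free_gram.
have Cunit : C^T *m C \in unitmx.
  by rewrite -{2}[C]trmxK; apply: row_free_gram; rewrite /row_free mxrank_tr.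
pose G := F^T *m invmx (F *m F^T); pose D := invmx (C^T *m C) *m C^T.
have FG : F *m G = 1%:M by rewrite mulmxA mulmxV.
have DC : D *m C = 1%:M by rewrite -mulmxA mulVmx.
have AGD : A *m (G *m D) = C *m D by rewrite AE -mulmxA (mulmxA F) FG mul1mx.
have GDA : (G *m D) *m A = G *m F by rewrite AE -mulmxA (mulmxA D) DC mul1mx.
exists (G *m D); split.
- by rewrite AGD AE -mulmxA (mulmxA D) DC mul1mx.
- by rewrite GDA -mulmxA (mulmxA F) FG mul1mx.
- rewrite AGD /D !trmx_mul trmxK trmx_inv trmx_mul trmxK.
  by rewrite mulmxA.
- rewrite GDA /G !trmx_mul trmxK trmx_inv trmx_mul trmxK.
  by rewrite mulmxA.
Qed.

End PseudoInverse.

Section Derivatives.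
Variables (R : realType) (n : nat).
Implicit Types (h : 'cV[R]_n -> R) (x : 'cV[R]_n) (U : set 'cV[R]_n).

Definition partial (i : 'I_n) h : 'cV[R]_n -> R := 'D_(delta_mx i 0) h.

Definition grad h x : 'cV[R]_n := \col_i partial i h x.

Definition hess h x : 'M[R]_n := \matrix_(i, j) partial j (partial i h) x.

Fixpoint Ck_on (r : nat) U h : Prop :=
  (forall x, U x -> {for x, continuous h}) /\
  (if r is r'.+1 then
     forall i, (forall x, U x -> derivable h x (delta_mx i 0)) /\
               Ck_on r' U (partial i h)
   else True).

Definition grad_lipschitz_on U h (L : R) : Prop :=
  forall x y, U x -> U y -> enorm (grad h x - grad h y) <= L * enorm (x - y).

Definition hess_lipschitz_on U h (L : R) : Prop :=
  forall x y, U x -> U y -> opnorm (hess h x - hess h y) <= L * enorm (x - y).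

End Derivatives.

Section SimplexDerivatives.
Variables (R : realType) (n : nat).
Implicit Types (h f g : 'cV[R]_n -> R) (x : 'cV[R]_n).

(* The directions s^1, ..., s^m are the columns of a matrix. *)
Definition dir_radius m (S : 'M[R]_(n, m)) : R :=
  \big[Num.max/0]_(i < m) enorm (col i S).

Definition mxhat m (S : 'M[R]_(n, m)) : 'M[R]_(n, m) := (dir_radius S)^-1 *: S.

Definition dir_radius_max m k (S : 'M[R]_(n, m)) (T : 'M[R]_(n, k)) : R :=
  Num.max (dir_radius S) (dir_radius T).

Definition dir_radius_min m k (S : 'M[R]_(n, m)) (T : 'M[R]_(n, k)) : R :=
  Num.min (dir_radius S) (dir_radius T).

Definition sgrad k h x (T : 'M[R]_(n, k)) : 'cV[R]_n :=
  mpinv T^T *m \col_j (h (x + col j T) - h x).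

Definition shess m k h x (S : 'M[R]_(n, m)) (T : 'M[R]_(n, k)) : 'M[R]_n :=
  mpinv S^T *m
    \matrix_(i < m, j < n) (sgrad h (x + col i S) T - sgrad h x T) j 0.

Definition sample_set m k x (S : 'M[R]_(n, m)) (T : 'M[R]_(n, k)) :
    set 'cV[R]_n :=
  [set x] `|` [set x + col i S | i in setT] `|` [set x + col j T | j in setT]
  `|` [set y | exists i j, y = x + col i S + col j T].

End SimplexDerivatives.

Section QuadraticInterpolation.
Variables (R : realType) (n : nat).
Implicit Types (h : 'cV[R]_n -> R) (x z : 'cV[R]_n) (Y : set 'cV[R]_n).

Definition quad_p (d : nat) : nat := ((d.+1 * d.+2)./2).-1.

(* [(a0, a, H)] encodes x |-> a0 + a^T x + x^T H x / 2. *)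
Definition quad_eval (q : R * 'cV[R]_n * 'M[R]_n) x : R :=
  q.1.1 + (q.1.2^T *m x) 0 0 + 2^-1 * (x^T *m q.2 *m x) 0 0.

Definition quad_interpolates Y h (q : R * 'cV[R]_n * 'M[R]_n) : Prop :=
  q.2^T = q.2 /\ forall y, Y y -> quad_eval q y = h y.

Definition poised Y : Prop :=
  (Y #= `I_(quad_p n).+1)%card /\ exists! q, quad_interpolates Y (fun=> 0) q.

Definition quad_interp Y h : 'cV[R]_n -> R :=
  quad_eval (xget (0, 0, 0) [set q | quad_interpolates Y h q]).

Definition quad_row z : seq R :=
  [seq z a 0 | a <- enum 'I_n] ++
  [seq 2^-1 * z a 0 ^+ 2 | a <- enum 'I_n] ++
  [seq z a 0 * z b 0 | a : 'I_n <- enum 'I_n,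
                       b : 'I_n <- [seq b : 'I_n <- enum 'I_n | (a < b)%N]].

Lemma size_quad_row z : size (quad_row z) = quad_p n.
Proof.
rewrite !size_cat size_allpairs_dep !size_map -enumT size_enum_ord.
rewrite sumnE big_map big_enum /=.
have -> : (\sum_(a < n) size [seq b : 'I_n <- enum 'I_n | (a < b)%N]
           = 'C(n, 2))%N.
  under eq_bigr do rewrite size_filter -sum1_count big_enum_cond /=.
  rewrite (exchange_big_dep xpredT)//= -bin2_sum big_mkord.
  apply: eq_bigr => b _; rewrite (big_ord_narrow (ltnW (ltn_ord b))).
  by rewrite sum1_card card_ord.
rewrite /quad_p mulnC -[n.+1]/n.+2.-1 -bin2 binS bin1 binS bin1 addnS /=.
by rewrite addnC [(n + _)%N]addnC.
Qed.

(* [y] enumerates the sample set starting from the base point [y ord0], which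
   contributes no row; [d] is the scaling factor, Delta_S + Delta_T in use. *)
Definition Qhat (y : 'I_(quad_p n).+1 -> 'cV[R]_n) (d : R) : 'M[R]_(quad_p n) :=
  \matrix_(i, j) nth 0 (quad_row (d^-1 *: (y (lift ord0 i) - y ord0))) j.

End QuadraticInterpolation.

Section CalculusHessians.
Variables (R : realType) (n m k : nat).
Implicit Types (f g h : 'cV[R]_n -> R) (x : 'cV[R]_n).
Implicit Types (S : 'M[R]_(n, m)) (T : 'M[R]_(n, k)).

Definition grad_Q h x S T : 'cV[R]_n :=
  grad (quad_interp (sample_set x S T) h) x.

Definition hess_sc f g x S T : 'M[R]_n :=
  g x *: shess f x S T + sgrad f x T *m (sgrad g x T)^T
  + sgrad g x T *m (sgrad f x T)^T + f x *: shess g x S T.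

Definition hess_qc f g x S T : 'M[R]_n :=
  g x *: shess f x S T + grad_Q f x S T *m (grad_Q g x S T)^T
  + grad_Q g x S T *m (grad_Q f x S T)^T + f x *: shess g x S T.

(* In the error constants, [L] is a Lipschitz constant of the gradient
   (E_sgrad) or of the Hessian (E_shess, E_gradQ). *)
Definition E_sgrad T (L : R) : R :=
  Num.sqrt k%:R / 2 * L * opnorm (mpinv (mxhat T)^T).

Definition E_shess S T (L : R) : R :=
  m%:R * Num.sqrt k%:R / 3 * L
  * (2 * (dir_radius_max S T / dir_radius_min S T) + 3)
  * opnorm (mpinv (mxhat S)^T) * opnorm (mpinv (mxhat T)).

Definition E_gradQ (y : 'I_(quad_p n).+1 -> 'cV[R]_n) S T (L : R) : R :=
  6 * (1 + Num.sqrt 2) * Num.sqrt (quad_p n)%:R * L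
  * opnorm (invmx (Qhat y (dir_radius S + dir_radius T))).

End CalculusHessians.

(* Main.v *)
Require Import Defs.
From mathcomp Require Import all_boot all_order all_algebra.
From mathcomp Require Import all_classical all_reals all_analysis.
From mathcomp Require Import ring lra.
Set Implicit Arguments.
Unset Strict Implicit.
Unset Printing Implicit Defensive.
Import Order.TTheory GRing.Theory Num.Theory.
Import numFieldNormedType.Exports.
Local Open Scope classical_set_scope.
Local Open Scope ring_scope.

(** Both approximate Hessians have the shape of the product rule
    g H_f + (grad f)(grad g)^T + (grad g)(grad f)^T + f H_g, with each gradient
    and Hessian replaced by an approximation.  The error is therefore at most
    the errors of the two nested-set Hessians, weighted by |g x0| and |f x0|,
    plus twice the error of one rank-one term a b^T - u v^T.  That error can be
    expanded in three ways, around (u, v), (b, u) or (a, v), whence the minimum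
    of three expressions ([outer_error], [product_error]).

    Simplex gradient and nested-set Hessian.  As T has full row rank, the
    pseudoinverse of T^T is a left inverse of T^T; so grad h is the
    pseudoinverse applied to the directional derivatives t^j . grad h, and the
    error of the simplex gradient is the pseudoinverse applied to first-order
    Taylor remainders.  In the same way the nested-set Hessian is
    (S^T)^+ M T^+, where M has the mixed second differences
    h(x0+s+t) - h(x0+s) - h(x0+t) + h(x0) as entries, while the Hessian is
    (S^T)^+ (S^T H T) T^+.  A mixed difference is s^T H t up to
    L |s||t| (|s| + |t|) / 2, and a matrix with entries bounded by c has norm
    at most sqrt(m k) c ([shess_error]).

    Quadratic interpolation.  In the monomial basis centred at x0 and scaled by
    r = Delta_S + Delta_T, the difference between the interpolant and the
    second-order Taylor polynomial of h is a coefficient vector which Qhat maps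
    to the Taylor remainders at the sample points.  Multiplying by the inverse
    of Qhat bounds this vector, and its first n entries are r times the error
    of the gradient ([grad_interp_error]).  The quadratic form of the Taylor
    polynomial only sees the symmetric part of the Hessian matrix, which is
    the one compared with the symmetric matrix of the interpolant.

    Taylor estimates.  All of them follow from the mean value theorem along
    segments.  The derivative of h along a segment is obtained from partial
    derivatives alone: when these are Lipschitz, moving one coordinate at a
    time gives a remainder of order |v|^2 ([lipschitz_partials_remainder]).
    The hypothesis on closed balls gives Delta_S + Delta_T < Dbar
    ([radius_sum_lt]), so that every segment in use stays inside the ball. *)

Lemma addrKB (V : zmodType) (x v : V) : x + v - x = v.
Proof. by rewrite addrC addKr. Qed.

(** * Euclidean norm and induced matrix norm *)

Section EuclideanNorm.
Context {R : realType}.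

(** The form (u^T v) 0 0 makes [dot] the linear part of [quad_eval] by
    conversion. *)
Definition dot n (u v : 'cV[R]_n) : R := (u^T *m v) 0 0.

Lemma dotE n (u v : 'cV[R]_n) : dot u v = \sum_i u i 0 * v i 0.
Proof. by rewrite /dot mxE; apply: eq_bigr => i _; rewrite mxE. Qed.

Lemma dotC n (u v : 'cV[R]_n) : dot u v = dot v u.
Proof. by rewrite !dotE; apply: eq_bigr => i _; rewrite mulrC. Qed.

Lemma dotDr n (u v w : 'cV[R]_n) : dot u (v + w) = dot u v + dot u w.
Proof. by rewrite /dot mulmxDr mxE. Qed.

Lemma dotZr n (a : R) (u v : 'cV[R]_n) : dot u (a *: v) = a * dot u v.
Proof. by rewrite /dot -scalemxAr mxE. Qed.

Lemma dotNr n (u v : 'cV[R]_n) : dot u (- v) = - dot u v.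
Proof. by rewrite -scaleN1r dotZr mulN1r. Qed.

Lemma dotBr n (u v w : 'cV[R]_n) : dot u (v - w) = dot u v - dot u w.
Proof. by rewrite dotDr dotNr. Qed.

Lemma dotDl n (u v w : 'cV[R]_n) : dot (v + w) u = dot v u + dot w u.
Proof. by rewrite dotC dotDr !(dotC u). Qed.

Lemma dotZl n (a : R) (u v : 'cV[R]_n) : dot (a *: u) v = a * dot u v.
Proof. by rewrite dotC dotZr dotC. Qed.

Lemma dotBl n (u v w : 'cV[R]_n) : dot (v - w) u = dot v u - dot w u.
Proof. by rewrite dotC dotBr !(dotC u). Qed.

Lemma dot0r n (u : 'cV[R]_n) : dot u 0 = 0.
Proof. by rewrite /dot mulmx0 mxE. Qed.

Lemma dot_trmx m n (A : 'M[R]_(m, n)) u v : dot (A^T *m u) v = dot u (A *m v).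
Proof. by rewrite /dot trmx_mul trmxK mulmxA. Qed.

Lemma dot_mxsym n (A : 'M[R]_n) u v :
  A^T = A -> dot u (A *m v) = dot v (A *m u).
Proof. by move=> As; rewrite -dot_trmx As dotC. Qed.

Lemma enormE n (u : 'cV[R]_n) : enorm u ^+ 2 = dot u u.
Proof.
rewrite /enorm sqr_sqrtr ?sumr_ge0// => [|i _]; last exact: sqr_ge0.
by rewrite dotE; apply: eq_bigr => i _; rewrite expr2.
Qed.

Lemma enorm_ge0 n (u : 'cV[R]_n) : 0 <= enorm u.
Proof. exact: sqrtr_ge0. Qed.

Lemma enorm_le n (u : 'cV[R]_n) c : 0 <= c -> dot u u <= c ^+ 2 -> enorm u <= c.
Proof. by move=> c0; rewrite -enormE ler_pXn2r// nnegrE enorm_ge0. Qed.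

Lemma enorm0 n : enorm (0 : 'cV[R]_n) = 0.
Proof.
apply/eqP; rewrite eq_le enorm_ge0 andbT.
by apply: enorm_le; rewrite // dot0r expr0n.
Qed.

Lemma enorm_eq0 n (u : 'cV[R]_n) : enorm u = 0 -> u = 0.
Proof.
move=> u0; have := enormE u; rewrite u0 expr0n dotE => /esym/eqP.
rewrite psumr_eq0 => [/allP w|i _]; last by rewrite -expr2 sqr_ge0.
apply/colP => i; have := w i (mem_index_enum _).
by rewrite mulf_eq0 orbb mxE => /eqP.
Qed.

Lemma enormZ n (a : R) (u : 'cV[R]_n) : enorm (a *: u) = `|a| * enorm u.
Proof.
apply/eqP; rewrite -(@eqrXn2 _ 2)// ?mulr_ge0 ?enorm_ge0//.
by rewrite exprMn !enormE dotZl dotZr real_normK ?num_real// mulrA expr2.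
Qed.

Lemma enormN n (u : 'cV[R]_n) : enorm (- u) = enorm u.
Proof. by rewrite -scaleN1r enormZ normrN1 mul1r. Qed.

Lemma cauchy_schwarz n (u v : 'cV[R]_n) : `|dot u v| <= enorm u * enorm v.
Proof.
wlog suff cs : v / dot u v <= enorm u * enorm v.
  rewrite ler_norml cs andbT lerNl -dotNr -(enormN v); exact: cs.
have [/enorm_eq0 ->|a0] := eqVneq (enorm u) 0.
  by rewrite dotC dot0r mulr_ge0 ?enorm_ge0.
have [/enorm_eq0 ->|b0] := eqVneq (enorm v) 0.
  by rewrite dot0r mulr_ge0 ?enorm_ge0.
have ab0 : 0 < enorm u * enorm v by rewrite mulr_gt0// lt0r ?a0 ?b0 enorm_ge0.
have := sqr_ge0 (enorm (enorm v *: u - enorm u *: v)).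
rewrite enormE !(dotBl, dotBr, dotZl, dotZr) -!enormE (dotC v u).
set a := enorm u in ab0 *; set b := enorm v in ab0 *.
by move=> h; rewrite -(ler_pM2l ab0); lra.
Qed.

Lemma enormD n (u v : 'cV[R]_n) : enorm (u + v) <= enorm u + enorm v.
Proof.
apply: enorm_le; first by rewrite addr_ge0 ?enorm_ge0.
rewrite dotDl !dotDr (dotC v u) -!enormE.
have := le_trans (ler_norm _) (cauchy_schwarz u v).
by move=> h; nra.
Qed.

Lemma enorm_coord n (u : 'cV[R]_n) i : `|u i 0| <= enorm u.
Proof.
rewrite -(ler_pXn2r (n := 2)) ?nnegrE ?enorm_ge0//.
rewrite enormE dotE real_normK ?num_real// (bigD1 i)//= -expr2 lerDl.
by apply: sumr_ge0 => j _; rewrite -expr2 sqr_ge0.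
Qed.

Lemma enorm_delta n (i : 'I_n) : enorm (delta_mx i 0 : 'cV[R]_n) = 1.
Proof.
apply/eqP; rewrite -(@eqrXn2 _ 2)// ?enorm_ge0// enormE dotE (bigD1 i)//=.
rewrite big1 ?addr0 ?mxE ?eqxx ?mulr1 ?expr1n// => j ji.
by rewrite mxE (negbTE ji) mul0r.
Qed.

Lemma enorm_bound n (u : 'cV[R]_n) c : 0 <= c ->
  (forall i, `|u i 0| <= c) -> enorm u <= Num.sqrt n%:R * c.
Proof.
move=> c0 uc; apply: enorm_le; first by rewrite mulr_ge0 ?sqrtr_ge0.
rewrite exprMn sqr_sqrtr ?ler0n// dotE.
have -> : n%:R * c ^+ 2 = \sum_(i < n) c ^+ 2.
  by rewrite sumr_const card_ord mulr_natl.
apply: ler_sum => i _.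
by rewrite -expr2 -[leLHS]real_normK ?num_real// ler_pXn2r ?nnegrE.
Qed.

Lemma opnorm_ub m n (A : 'M[R]_(m, n)) x :
  enorm x <= 1 -> enorm (A *m x) <= opnorm A.
Proof.
move=> x1; have [_ ub] := opnorm_has_sup A.
by apply: ub_le_sup => //; exists x.
Qed.

Lemma opnorm_ge0 m n (A : 'M[R]_(m, n)) : 0 <= opnorm A.
Proof.
by apply: le_trans (@opnorm_ub _ _ A 0 _); rewrite ?enorm_ge0// enorm0.
Qed.

Lemma enorm_mulmx m n (A : 'M[R]_(m, n)) x :
  enorm (A *m x) <= opnorm A * enorm x.
Proof.
have [/enorm_eq0 ->|x0] := eqVneq (enorm x) 0.
  by rewrite mulmx0 !enorm0 mulr0.
have xp : 0 < enorm x by rewrite lt0r x0 enorm_ge0.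
have := @opnorm_ub _ _ A ((enorm x)^-1 *: x).
rewrite enormZ -scalemxAr enormZ ger0_norm ?invr_ge0 ?enorm_ge0//.
by rewrite mulVf// lexx => /(_ isT); rewrite ler_pdivrMl// mulrC.
Qed.

Lemma opnorm_le m n (A : 'M[R]_(m, n)) c : 0 <= c ->
  (forall x, enorm (A *m x) <= c * enorm x) -> opnorm A <= c.
Proof.
move=> c0 Ac; apply: ge_sup; first by have [] := opnorm_has_sup A.
move=> _ [x /= x1 <-]; apply: le_trans (Ac x) _.
by rewrite ler_piMr.
Qed.

Lemma opnormD m n (A B : 'M[R]_(m, n)) : opnorm (A + B) <= opnorm A + opnorm B.
Proof.
apply: opnorm_le => [|x]; first by rewrite addr_ge0 ?opnorm_ge0.
by rewrite mulmxDl (le_trans (enormD _ _))// mulrDl lerD ?enorm_mulmx.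
Qed.

Lemma opnormM m n p (A : 'M[R]_(m, n)) (B : 'M[R]_(n, p)) :
  opnorm (A *m B) <= opnorm A * opnorm B.
Proof.
apply: opnorm_le => [|x]; first by rewrite mulr_ge0 ?opnorm_ge0.
rewrite -mulmxA (le_trans (enorm_mulmx _ _))// -mulrA.
by rewrite ler_wpM2l ?opnorm_ge0 ?enorm_mulmx.
Qed.

Lemma opnormZ m n (a : R) (A : 'M[R]_(m, n)) :
  opnorm (a *: A) <= `|a| * opnorm A.
Proof.
apply: opnorm_le => [|x]; first by rewrite mulr_ge0 ?opnorm_ge0.
by rewrite -scalemxAl enormZ -mulrA ler_wpM2l ?enorm_mulmx.
Qed.

Lemma opnorm_outer m n (u : 'cV[R]_m) (v : 'cV[R]_n) :
  opnorm (u *m v^T) <= enorm u * enorm v.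
Proof.
apply: opnorm_le => [|x]; first by rewrite mulr_ge0 ?enorm_ge0.
have -> : u *m v^T *m x = dot v x *: u.
  by rewrite -mulmxA [v^T *m x]mx11_scalar mul_mx_scalar.
by rewrite enormZ mulrC -mulrA ler_wpM2l ?enorm_ge0 ?cauchy_schwarz.
Qed.

(** Comparison with the Frobenius norm: Cauchy-Schwarz on each row. *)
Lemma opnorm_bound m n (A : 'M[R]_(m, n)) c : 0 <= c ->
  (forall i j, `|A i j| <= c) -> opnorm A <= Num.sqrt m%:R * Num.sqrt n%:R * c.
Proof.
move=> c0 Ac; apply: opnorm_le => [|x]; first by rewrite !mulr_ge0 ?sqrtr_ge0.
rewrite -!mulrA; apply: enorm_bound => [|i].
  by rewrite !mulr_ge0 ?sqrtr_ge0 ?enorm_ge0.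
have -> : (A *m x) i 0 = dot (row i A)^T x.
  by rewrite /dot trmxK -row_mul [RHS]mxE.
apply: le_trans (cauchy_schwarz _ _) _; rewrite mulrA ler_wpM2r ?enorm_ge0//.
by apply: enorm_bound => // j; rewrite !mxE.
Qed.

Lemma opnorm_coord m n (A : 'M[R]_(m, n)) i j : `|A i j| <= opnorm A.
Proof.
have -> : A i j = (A *m (delta_mx j 0 : 'cV_n)) i 0 by rewrite -colE mxE.
by apply: le_trans (enorm_coord _ _) _; rewrite opnorm_ub ?enorm_delta.
Qed.

Lemma dot_mulmx_le m n u (A : 'M[R]_(m, n)) v :
  `|dot u (A *m v)| <= opnorm A * (enorm u * enorm v).
Proof.
apply: le_trans (cauchy_schwarz _ _) _.
by rewrite mulrCA ler_wpM2l ?enorm_ge0 ?enorm_mulmx.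
Qed.

End EuclideanNorm.

(** * Moore-Penrose pseudoinverse *)

Section PinvFacts.
Context {R : realType}.

Lemma mpinv_tr m n (A : 'M[R]_(m, n)) : mpinv A^T = (mpinv A)^T.
Proof.
apply: (moore_penrose_uniq (mpinvP _)).
have [ABA BAB ABt BAt] := mpinvP A.
split; rewrite -?trmx_mul ?mulmxA ?ABA ?BAB ?ABt ?BAt//.
all: by rewrite -trmx_mul mulmxA ?ABA ?BAB.
Qed.

Lemma mpinvZ m n (c : R) (A : 'M[R]_(m, n)) : c != 0 ->
  mpinv (c *: A) = c^-1 *: mpinv A.
Proof.
move=> c0; apply: (moore_penrose_uniq (mpinvP _)).
have [ABA BAB ABt BAt] := mpinvP A.
split; rewrite -!(scalemxAl, scalemxAr) !scalerA ?mulfV ?mulVf// ?scale1r//.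
- by rewrite ABA mulr1.
- by rewrite BAB divfK.
Qed.

Lemma mulmx_mpinv m n (A : 'M[R]_(m, n)) : row_free A -> A *m mpinv A = 1%:M.
Proof.
move=> Af; have [ABA _ _ _] := mpinvP A.
by apply: (row_free_inj Af); rewrite ABA mul1mx.
Qed.

End PinvFacts.

(** * Mean value estimates in one variable *)

Section OneVariable.
Context {R : realType}.

(** A remainder of order e^2 makes the difference quotient converge. *)
Lemma is_derive_quadratic (V : normedModType R) (h : V -> R) x v (c K d : R) :
  0 < d ->
  (forall e, `|e| < d -> `|h (x + e *: v) - h x - e * c| <= K * e ^+ 2) ->
  is_derive x v h c.
Proof.
move=> d0 hK.
suff cv : (fun e => e^-1 *: ((h \o shift x) (e *: v) - h x)) @ 0^' --> c.
  apply: DeriveDef; last exact: cvg_lim cv.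
  by apply/cvg_ex; exists c.
apply/cvgrPdist_le => /= eps eps0.
pose K1 := `|K| + 1.
have K10 : 0 < K1 by rewrite ltr_wpDl.
near=> e.
have e0 : e != 0 by near: e; exact: nbhs_dnbhs_neq.
have ed : `|e| < d.
  near: e; apply: dnbhs0_lt => //.
have eK : `|e| < eps / K1.
  near: e; apply: dnbhs0_lt; by rewrite divr_gt0.
have := hK e ed; rewrite addrC [x + _]addrC => hKe.
have -> : c - e^-1 *: (h (e *: v + x) - h x)
    = - e^-1 * (- (e * c) + (h (e *: v + x) - h x)).
  by rewrite /GRing.scale/=; field.
rewrite normrM normrN normfV ler_pdivrMl ?normr_gt0//.
apply: le_trans hKe _; apply: le_trans (ler_norm _) _.
rewrite normrM normrX expr2.
rewrite mulrCA ler_wpM2l//.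
move: eK; rewrite ltr_pdivlMr// => /ltW; apply: le_trans.
by rewrite mulrC ler_wpM2l// lerDl.
Unshelve. all: by end_near. Qed.

Lemma mvt01 (phi dphi : R -> R) :
  (forall a : R, 0 <= a <= 1 -> is_derive a 1 phi (dphi a)) ->
  exists2 c : R, 0 <= c <= 1 & phi 1 - phi 0 = dphi c.
Proof.
move=> dP.
have [c c01 ->] : exists2 c, c \in `[0, 1]%R & phi 1 - phi 0 = dphi c * (1 - 0).
  apply: MVT_segment => // [x|].
    by rewrite in_itv/= => /andP[x0 x1]; apply: dP; rewrite !ltW.
  apply: derivable_within_continuous => x; rewrite in_itv/= => x01.
  by have [] := dP _ x01.
by exists c; [rewrite in_itv in c01 | rewrite subr0 mulr1].
Qed.

Lemma is_derive_mulr (c a : R) : is_derive a 1 ( *%R^~ c : R -> R) c.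
Proof.
apply: (@is_derive_quadratic _ _ _ _ _ 0 1) => // e _.
rewrite (mulr1 e : e *: (1 : R) = e) mulrDl [a * c + _]addrC addrK.
by rewrite subrr normr0 mul0r.
Qed.

(** The primitive of A + B a; subtracting it turns an affine bound on a
    derivative into a sign. *)
Definition affine_primitive (A B : R) (a : R) : R := A * a + B / 2 * a ^+ 2.

Lemma is_derive_affine_primitive (A B a : R) :
  is_derive a 1 (affine_primitive A B) (A + B * a).
Proof.
apply: (@is_derive_quadratic _ _ _ _ _ `|B / 2| 1) => // e _.
rewrite -[e ^+ 2]ger0_norm ?sqr_ge0// -normrM le_eqVlt; apply/orP; left.
apply/eqP; congr `| _ |; rewrite (mulr1 e : e *: (1 : R) = e).
by rewrite /affine_primitive; field.
Qed.

Lemma mvt_affine_le (phi dphi : R -> R) (A B : R) :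
  (forall a : R, 0 <= a <= 1 -> is_derive a 1 phi (dphi a)) ->
  (forall a : R, 0 <= a <= 1 -> dphi a <= A + B * a) ->
  phi 1 - phi 0 <= A + B / 2.
Proof.
move=> dP dle.
have [c c01] := @mvt01 (phi - affine_primitive A B)
  (fun a => dphi a - (A + B * a))
  (fun a a01 => is_deriveB (dP a a01)
    (is_derive_affine_primitive A B a)).
rewrite !fctE /affine_primitive => e; have := dle _ c01.
by move: e; rewrite expr0n/= expr1n; lra.
Qed.

(** Replaces integrating the bound A + B a over [0, 1]. *)
Lemma mvt_affine (phi dphi : R -> R) (A B : R) :
  (forall a : R, 0 <= a <= 1 -> is_derive a 1 phi (dphi a)) ->
  (forall a : R, 0 <= a <= 1 -> `|dphi a| <= A + B * a) ->
  `|phi 1 - phi 0| <= A + B / 2.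
Proof.
move=> dP dle; rewrite ler_norml; apply/andP; split; last first.
  by apply: mvt_affine_le dP _ => a /dle; exact: le_trans (ler_norm _).
have : (- phi) 1 - (- phi) 0 <= A + B / 2.
  apply: (@mvt_affine_le (- phi) (fun a => - dphi a)) => [a a01|a /dle].
    by apply: is_deriveN; exact: dP.
  by apply: le_trans; rewrite -normrN ler_norm.
by rewrite !fctE; lra.
Qed.

End OneVariable.

(** * Differentiability along lines from Lipschitz partial derivatives *)

Section LipschitzPartials.
Context {R : realType} {n : nat}.
Implicit Types (h : 'cV[R]_n -> R) (x p v d : 'cV[R]_n).

Lemma is_derive_partial_line h p i (b : R) :
  derivable h (p + b *: delta_mx i 0) (delta_mx i 0) ->
  is_derive b 1 (fun b => h (p + b *: delta_mx i 0))
    (partial i h (p + b *: delta_mx i 0)).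
Proof.
move=> dh.
have E : (fun e => e^-1 *: (((fun b => h (p + b *: delta_mx i 0)) \o shift b)
           (e *: 1) - h (p + b *: delta_mx i 0)))
  = (fun e => e^-1 *: ((h \o shift (p + b *: delta_mx i 0)) (e *: delta_mx i 0)
       - h (p + b *: delta_mx i 0))).
  apply/funext => e /=; congr (_ *: (h _ - _)).
  by rewrite (mulr1 e : e *: (1 : R) = e) scalerDl addrCA.
split; first by rewrite /derivable E.
by rewrite /partial /derive E.
Qed.

(** Stated on the segment from p to p + c e_i, so that the sign of c does not
    matter. *)
Lemma mvt_coord h p i (c : R) :
  (forall a : R, 0 <= a <= 1 ->
     derivable h (p + (a * c) *: delta_mx i 0) (delta_mx i 0)) ->
  exists2 a : R, 0 <= a <= 1 & h (p + c *: delta_mx i 0) - h p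
    = c * partial i h (p + (a * c) *: delta_mx i 0).
Proof.
move=> dh.
have [a a01 e] := @mvt01 _ ((fun b => h (p + b *: delta_mx i 0)) \o *%R^~ c)
  (fun a => partial i h (p + (a * c) *: delta_mx i 0) * c)
  (fun a a01 => @is_derive1_comp _ _ ( *%R^~ c) _ _ _ 
     (is_derive_partial_line (dh a a01)) (is_derive_mulr c a)).
by exists a => //; rewrite mulrC -e /= mul1r mul0r scale0r addr0.
Qed.

Lemma enorm_mono (u v : 'cV[R]_n) :
  (forall i, `|u i 0| <= `|v i 0|) -> enorm u <= enorm v.
Proof.
move=> uv; apply: enorm_le; first exact: enorm_ge0.
rewrite enormE !dotE; apply: ler_sum => i _; rewrite -!expr2.
rewrite -[u i 0 ^+ 2]real_normK ?num_real//.
by rewrite -[v i 0 ^+ 2]real_normK ?num_real// ler_pXn2r ?nnegrE.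
Qed.

Lemma eballD (x0 x v : 'cV[R]_n) (D : R) :
  enorm (x - x0) + enorm v < D -> eball x0 D (x + v).
Proof.
by rewrite /eball/= addrAC; apply: le_lt_trans; exact: enormD.
Qed.

Lemma eball_segment (x0 v : 'cV[R]_n) (a D : R) :
  0 <= a <= 1 -> enorm v < D -> eball x0 D (x0 + a *: v).
Proof.
move=> /andP[a0 a1] vD; apply: eballD.
rewrite subrr enorm0 add0r enormZ ger0_norm//; apply: le_lt_trans vD.
by rewrite ler_piMl ?enorm_ge0.
Qed.

Variables (x0 : 'cV[R]_n) (D : R).

(** Entrywise Lipschitz bounds are the common consequence of a Lipschitz
    gradient, for h, and of a Lipschitz Hessian, for each partial derivative
    of h. *)
Definition lipschitz_partials h (L : R) := forall i,
  (forall x, eball x0 D x -> derivable h x (delta_mx i 0)) /\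
  (forall x y, eball x0 D x -> eball x0 D y ->
     `|partial i h x - partial i h y| <= L * enorm (x - y)).

(** Go from x to x + v by changing one coordinate at a time: step j is
    v_j times a partial derivative at a point within |v| of x, which differs
    from the partial derivative at x by at most L |v|. *)
Lemma lipschitz_partials_remainder h L x v : 0 <= L ->
  lipschitz_partials h L ->
  enorm (x - x0) + enorm v < D ->
  `|h (x + v) - h x - dot (grad h x) v| <= n%:R * L * enorm v ^+ 2.
Proof.
move=> L0 hL xvD.
(* w j is v truncated to its first j coordinates. *)
pose w j : 'cV[R]_n := \col_i (if (i < j)%N then v i 0 else 0).
have w0 : x + w 0 = x.
  by apply/colP => i; rewrite !mxE addr0.
have wn : x + w n = x + v.
  by apply/colP => i; rewrite !mxE ltn_ord.
have wS (j : 'I_n) : w j.+1 = w j + v j 0 *: delta_mx j 0.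
  apply/colP => i; rewrite !mxE eqxx andbT ltnS leq_eqVlt -val_eqE/=.
  case: eqVneq => [/val_inj ->|ij] /=; first by rewrite ltnn add0r mulr1.
  by rewrite mulr0 addr0.
have wv (j : 'I_n) (a : R) : 0 <= a <= 1 ->
    enorm (w j + (a * v j 0) *: delta_mx j 0) <= enorm v.
  move=> /andP[a0 a1]; apply: enorm_mono => i.
  rewrite !mxE eqxx andbT -val_eqE/=.
  case: ltngtP => [ij|ij|/val_inj ->]/=.
  - by rewrite mulr0 addr0.
  - by rewrite mulr0 addr0 normr0.
  - by rewrite add0r mulr1 normrM ger0_norm// ler_piMl.
have Uw (j : 'I_n) (a : R) : 0 <= a <= 1 ->
    eball x0 D (x + w j + (a * v j 0) *: delta_mx j 0).
  move=> a01; rewrite -addrA; apply: eballD.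
  by apply: le_lt_trans xvD; rewrite lerD2l wv.
have Ux : eball x0 D x.
  by rewrite /eball/=; apply: le_lt_trans xvD; rewrite lerDl enorm_ge0.
have -> : h (x + v) - h x - dot (grad h x) v = \sum_(j < n)
    (h (x + w j.+1) - h (x + w j) - partial j h x * v j 0).
  rewrite sumrB -(big_mkord xpredT (fun j => h (x + w j.+1) - h (x + w j))).
  rewrite telescope_sumr// w0 wn dotE; congr (_ - _).
  by apply: eq_bigr => j _; rewrite mxE.
have -> : n%:R * L * enorm v ^+ 2 = \sum_(j < n) L * enorm v ^+ 2.
  by rewrite sumr_const card_ord -mulrA mulr_natl.
apply: le_trans (ler_norm_sum _ _ _) _; apply: ler_sum => j _.
have [a a01 e] := @mvt_coord h (x + w j) j (v j 0)
  (fun a a01 => (hL j).1 _ (Uw j a a01)).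
rewrite wS addrA e mulrC -mulrBl normrM.
have := (hL j).2 _ _ (Uw j a a01) Ux => h1.
rewrite expr2 mulrA ler_pM ?enorm_coord//.
by apply: le_trans h1 _; rewrite ler_wpM2l// addrAC [x + w j]addrC addrK wv.
Qed.

Lemma is_derive_line h L p d (a : R) : 0 <= L -> lipschitz_partials h L ->
  eball x0 D (p + a *: d) ->
  is_derive a 1 (fun a => h (p + a *: d)) (dot (grad h (p + a *: d)) d).
Proof.
move=> L0 hL; rewrite /eball/= => pD.
set r := D - enorm (p + a *: d - x0).
have r0 : 0 < r by rewrite subr_gt0.
have d0 : 0 < enorm d + 1 by rewrite ltr_wpDl ?enorm_ge0.
apply: (@is_derive_quadratic _ _ _ _ _ _ (n%:R * L * enorm d ^+ 2)
  (r / (enorm d + 1))); first by rewrite divr_gt0.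
move=> e er.
have -> : p + (a + e *: (1 : R)) *: d = p + a *: d + e *: d.
  by rewrite (mulr1 e : e *: (1 : R) = e) scalerDl addrA.
have -> : n%:R * L * enorm d ^+ 2 * e ^+ 2 = n%:R * L * enorm (e *: d) ^+ 2.
  by rewrite enormZ exprMn real_normK ?num_real//; ring.
rewrite -dotZr.
apply: lipschitz_partials_remainder => //.
rewrite enormZ -ltrBrDl -/r; move: er; rewrite ltr_pdivlMr//.
by apply: le_lt_trans; rewrite ler_wpM2l// lerDl.
Qed.

End LipschitzPartials.

(** * Taylor estimates around the centre of a ball *)

Section TaylorEstimates.
Context {R : realType} {n : nat}.
Variables (h : 'cV[R]_n -> R) (x0 : 'cV[R]_n) (D L1 L2 : R).
Hypothesis L10 : 0 <= L1.
Hypothesis L20 : 0 <= L2.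
Hypothesis lip1 : lipschitz_partials x0 D h L1.
Hypothesis lip2 : forall i, lipschitz_partials x0 D (partial i h) L2.
Hypothesis glip : grad_lipschitz_on (eball x0 D) h L1.
Hypothesis hlip : hess_lipschitz_on (eball x0 D) h L2.

Lemma grad_partial i x : grad (partial i h) x = (row i (hess h x))^T.
Proof. by apply/colP => j; rewrite !mxE. Qed.

Lemma taylor1 t : enorm t < D ->
  `|h (x0 + t) - h x0 - dot (grad h x0) t| <= L1 / 2 * enorm t ^+ 2.
Proof.
move=> tD; pose c := dot (grad h x0) t.
have := @mvt_affine _ ((fun a => h (x0 + a *: t)) - *%R^~ c)
  (fun a => dot (grad h (x0 + a *: t)) t - c) 0 (L1 * enorm t ^+ 2)
  (fun a a01 => is_deriveB
    (is_derive_line L10 lip1 (eball_segment x0 a01 tD)) (is_derive_mulr c a)).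
rewrite !fctE /= scale1r scale0r addr0 mul1r mul0r subr0 add0r addrAC.
rewrite (mulrAC L1); apply => a a01; rewrite add0r -dotBl.
apply: le_trans (cauchy_schwarz _ _) _.
have x0D : eball x0 D x0.
  have := @eball_segment _ _ x0 t 0 D.
  by rewrite scale0r addr0 lexx ler01; apply.
have := glip (eball_segment x0 a01 tD) x0D.
rewrite addrKB enormZ ger0_norm; last by case/andP: a01.
move=> hl; rewrite expr2 mulrA mulrAC ler_wpM2r ?enorm_ge0//.
by apply: le_trans hl _; rewrite mulrCA mulrC.
Qed.

(** The function b |-> s . grad h (p + b t) has derivative s^T H(p + b t) t,
    which is compared with s^T H(x0) t through the Lipschitz bound on H.  It
    serves both the mixed differences (p on the segment from x0 to x0 + s) and
    the second-order expansion (p = x0). *)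
Lemma grad_increment p s t : enorm (p - x0) + enorm t < D ->
  `|dot (grad h (p + t) - grad h p) s - dot s (hess h x0 *m t)|
  <= L2 * (enorm s * enorm t) * (enorm (p - x0) + enorm t / 2).
Proof.
move=> ptD; pose c := dot s (hess h x0 *m t).
have U (b : R) : 0 <= b <= 1 -> eball x0 D (p + b *: t).
  move=> /andP[b0 b1]; apply: eballD; apply: le_lt_trans ptD.
  by rewrite lerD2l enormZ ger0_norm// ler_piMl ?enorm_ge0.
have x0D : eball x0 D x0.
  rewrite /eball/= subrr enorm0; apply: le_lt_trans ptD.
  by rewrite addr_ge0 ?enorm_ge0.
pose psi (i : 'I_n) (b : R) : R := partial i h (p + b *: t).
have dpsi (b : R) : 0 <= b <= 1 ->
    is_derive b 1 ((\sum_i s i 0 *: psi i) - *%R^~ c)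
    (dot s (hess h (p + b *: t) *m t) - c).
  move=> b01; apply: is_deriveB; last exact: is_derive_mulr.
  have -> : dot s (hess h (p + b *: t) *m t)
      = \sum_i s i 0 *: dot (grad (partial i h) (p + b *: t)) t.
    rewrite dotE; apply: eq_bigr => i _.
    by rewrite grad_partial /dot trmxK -row_mul [in RHS]mxE.
  apply: is_derive_sum => i; apply: is_deriveZ.
  by apply: is_derive_line (L20) (lip2 i) (U _ b01).
have e (b : R) : ((\sum_i s i 0 *: psi i) - *%R^~ c) b
    = dot (grad h (p + b *: t)) s - b * c.
  rewrite !fctE fct_sumE; congr (_ - _).
  by rewrite dotC dotE; apply: eq_bigr => i _; rewrite mxE.
have := @mvt_affine _ _ _ (L2 * (enorm s * enorm t) * enorm (p - x0))
  (L2 * (enorm s * enorm t) * enorm t) dpsi.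
rewrite !e scale1r scale0r addr0 mul1r mul0r subr0 addrAC -dotBl.
rewrite mulrDr [_ * (_ / 2)]mulrA; apply => b b01.
rewrite -dotBr -mulmxBl.
apply: le_trans (dot_mulmx_le _ _ _) _.
have -> : L2 * (enorm s * enorm t) * enorm (p - x0)
    + L2 * (enorm s * enorm t) * enorm t * b
  = L2 * (enorm (p - x0) + enorm t * b) * (enorm s * enorm t) by ring.
rewrite ler_wpM2r ?mulr_ge0 ?enorm_ge0//.
apply: le_trans (hlip (U _ b01) x0D) _.
have /andP[b0 _] := b01.
rewrite ler_wpM2l// addrAC (le_trans (enormD _ _))// enormZ ger0_norm//.
by rewrite [b * _]mulrC lerD2l ler_wpM2l ?enorm_ge0.
Qed.

(** The derivative of a |-> h (x0 + t + a s) - h (x0 + a s) is an increment of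
    the gradient, to which [grad_increment] applies; its bound is affine
    in a. *)
Lemma mixed_difference s t : enorm s + enorm t < D ->
  `|h (x0 + s + t) - h (x0 + s) - (h (x0 + t) - h x0) - dot s (hess h x0 *m t)|
  <= L2 * (enorm s * enorm t) * ((enorm s + enorm t) / 2).
Proof.
move=> stD; pose c := dot s (hess h x0 *m t).
have st (a : R) : 0 <= a <= 1 -> enorm (x0 + a *: s - x0) = a * enorm s.
  by move=> /andP[a0 _]; rewrite addrKB enormZ ger0_norm.
have sa (a : R) : 0 <= a <= 1 -> a * enorm s <= enorm s.
  by move=> /andP[a0 a1]; rewrite ler_piMl ?enorm_ge0.
have U1 (a : R) : 0 <= a <= 1 -> eball x0 D (x0 + t + a *: s).
  move=> a01; rewrite addrAC; apply: eballD; rewrite st//.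
  by apply: le_lt_trans stD; rewrite lerD2r sa.
have U2 (a : R) : 0 <= a <= 1 -> eball x0 D (x0 + a *: s).
  move=> a01; apply: eball_segment => //; apply: le_lt_trans stD.
  by rewrite lerDl enorm_ge0.
have := @mvt_affine _
  ((fun a => h (x0 + t + a *: s)) - (fun a => h (x0 + a *: s)) - *%R^~ c)
  (fun a => dot (grad h (x0 + t + a *: s)) s
            - dot (grad h (x0 + a *: s)) s - c)
  (L2 * (enorm s * enorm t) * (enorm t / 2))
  (L2 * (enorm s * enorm t) * enorm s)
  (fun a a01 => is_deriveB (is_deriveB
    (is_derive_line L10 lip1 (U1 a a01)) (is_derive_line L10 lip1 (U2 a a01)))
    (is_derive_mulr c a)).
rewrite !fctE /= !scale1r !scale0r !addr0 mul1r mul0r subr0.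
have -> : h (x0 + t + s) - h (x0 + s) - c - (h (x0 + t) - h x0)
  = h (x0 + s + t) - h (x0 + s) - (h (x0 + t) - h x0) - c.
  rewrite (addrAC x0 t s); ring.
move=> H; apply: le_trans (H _) _; last by lra.
move=> a a01; rewrite -dotBl addrAC.
have := @grad_increment (x0 + a *: s) s t; rewrite st// => /(_ _)/le_trans.
apply; last by lra.
by apply: le_lt_trans stD; rewrite lerD2r sa.
Qed.

(** The sharp constant is L2 / 6; L2 / 4 results from bounding a^2 by a on
    [0, 1], so that [mvt_affine] applies. *)
Lemma taylor2 d : enorm d < D ->
  `|h (x0 + d) - h x0 - dot (grad h x0) d - 2^-1 * dot d (hess h x0 *m d)|
  <= L2 / 4 * enorm d ^+ 3.
Proof.
move=> dD; pose c := dot (grad h x0) d; pose c2 := dot d (hess h x0 *m d).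
have := @mvt_affine _ ((fun a => h (x0 + a *: d)) - affine_primitive c c2)
  (fun a => dot (grad h (x0 + a *: d)) d - (c + c2 * a))
  0 (L2 / 2 * enorm d ^+ 3)
  (fun a a01 => is_deriveB (is_derive_line L10 lip1 (eball_segment x0 a01 dD))
     (is_derive_affine_primitive c c2 a)).
rewrite !fctE /affine_primitive /= scale1r scale0r addr0 add0r expr1n expr0n/=.
rewrite !mulr0 !mulr1 addr0 subr0 => H.
have -> : h (x0 + d) - h x0 - c - 2^-1 * c2
    = h (x0 + d) - (c + c2 / 2) - h x0 by lra.
apply: le_trans (H _) _; last by lra.
move=> a /andP[a0 a1].
have ad : a * enorm d <= enorm d by rewrite ler_piMl ?enorm_ge0.
have := @grad_increment x0 d (a *: d).
rewrite subrr enorm0 !add0r enormZ ger0_norm// => /(_ (le_lt_trans ad dD)).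
rewrite -scalemxAr dotZr -/c2 dotBl -/c => h1.
have -> : dot (grad h (x0 + a *: d)) d - (c + c2 * a) = 
  dot (grad h (x0 + a *: d)) d - c - a * c2 by ring.
apply: le_trans h1 _.
have -> : L2 * (enorm d * (a * enorm d)) * (a * enorm d / 2)
   = (L2 / 2 * enorm d ^+ 3 * a) * a by field.
by rewrite ler_piMr// !mulr_ge0 ?exprn_ge0 ?enorm_ge0 ?invr_ge0.
Qed.

End TaylorEstimates.

Section LipschitzConstants.
Context {R : realType} {n : nat}.
Implicit Types (h : 'cV[R]_n -> R).

(** Shared by the gradient and the Hessian: the left-hand side of the
    Lipschitz inequality is only used through its sign. *)
Lemma lipschitz_const_ge0 (i : 'I_n) (x0 : 'cV[R]_n) (D L : R) :
  0 < D ->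
  (forall x y, eball x0 D x -> eball x0 D y -> 0 <= L * enorm (x - y)) ->
  0 <= L.
Proof.
move=> D0 /(_ (x0 + (D / 2) *: delta_mx i 0) x0).
have D20 : 0 < D / 2 by rewrite divr_gt0.
rewrite /eball/= subrr enorm0 addrKB enormZ enorm_delta mulr1 (gtr0_norm D20).
by move=> /(_ _ D0); rewrite pmulr_lge0//; apply; lra.
Qed.

Lemma Ck_lipschitz_partials r h x0 (D L : R) :
  Ck_on r.+1 (eball x0 D) h -> grad_lipschitz_on (eball x0 D) h L ->
  lipschitz_partials x0 D h L.
Proof.
move=> [_ hC] hL i; split; first by case: (hC i).
move=> x y Ux Uy; apply: le_trans (hL _ _ Ux Uy).
have -> : partial i h x - partial i h y = (grad h x - grad h y) i 0.
  by rewrite !mxE.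
exact: enorm_coord.
Qed.

Lemma Ck_lipschitz_second_partials r h x0 (D L : R) i :
  Ck_on r.+2 (eball x0 D) h -> hess_lipschitz_on (eball x0 D) h L ->
  lipschitz_partials x0 D (partial i h) L.
Proof.
move=> [_ /(_ i)[_ [_ hC]]] hL j; split; first by case: (hC j).
move=> x y Ux Uy; apply: le_trans (hL _ _ Ux Uy).
have -> : partial j (partial i h) x - partial j (partial i h) y
    = (hess h x - hess h y) i j by rewrite !mxE.
exact: opnorm_coord.
Qed.

End LipschitzConstants.

(** * Error of a product-rule expression *)

Section ProductErrors.
Context {R : realType} {n : nat}.
Implicit Types (u v a b : 'cV[R]_n).

(** The three ways of splitting a b^T - u v^T, with p = a - u and q = b - v:
    p q^T + u q^T + p v^T, then p b^T + u q^T, then a q^T + p v^T.  The factor c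
    is Delta_u for simplex gradients and Delta_u^2 for interpolants. *)
Lemma outer_error u v a b (eu ev c : R) : 0 <= c ->
  enorm (a - u) <= eu * c -> enorm (b - v) <= ev * c ->
  opnorm (a *m b^T - u *m v^T) <= c *
    Num.min (eu * ev * c + ev * enorm u + eu * enorm v)
   (Num.min (eu * enorm b + ev * enorm u) (ev * enorm a + eu * enorm v)).
Proof.
move=> c0 au bv; set p := a - u in au; set q := b - v in bv.
have trB : q^T = b^T - v^T by exact: linearB.
have aE : a = p + u by rewrite subrK.
have bE : b = q + v by rewrite subrK.
have out x y (ex ey : R) : enorm x <= ex -> enorm y <= ey ->
    opnorm (x *m y^T : 'M[R]_n) <= ex * ey.
  move=> hx hy; apply: le_trans (opnorm_outer _ _) _.
  by rewrite ler_pM ?enorm_ge0.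
rewrite !minr_pMr// !le_min; apply/and3P; split.
- have -> : a *m b^T - u *m v^T = p *m q^T + u *m q^T + p *m v^T.
    clearbody p q; rewrite aE bE linearD/= !mulmxDl !mulmxDr.
    by rewrite addrA addrK addrAC.
  apply: le_trans (opnormD _ _) _.
  apply: le_trans (lerD (opnormD _ _) (lexx _)) _.
  have := out _ _ _ _ au bv; have := out _ _ _ _ (lexx (enorm u)) bv.
  by have := out _ _ _ _ au (lexx (enorm v)); lra.
- have -> : a *m b^T - u *m v^T = p *m b^T + u *m q^T.
    by rewrite mulmxBl trB mulmxBr addrA subrK.
  apply: le_trans (opnormD _ _) _.
  have := out _ _ _ _ (lexx (enorm u)) bv.
  by have := out _ _ _ _ au (lexx (enorm b)); lra.
- have -> : a *m b^T - u *m v^T = a *m q^T + p *m v^T.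
    by rewrite mulmxBl trB mulmxBr addrA subrK.
  apply: le_trans (opnormD _ _) _.
  have := out _ _ _ _ (lexx (enorm a)) bv.
  by have := out _ _ _ _ au (lexx (enorm v)); lra.
Qed.

Lemma product_error (Af Ag Hf Hg : 'M[R]_n) u v a b (fx gx ef eg eu ev c : R) :
  0 <= c ->
  opnorm (Af - Hf) <= ef -> opnorm (Ag - Hg) <= eg ->
  enorm (a - u) <= eu * c -> enorm (b - v) <= ev * c ->
  opnorm (gx *: Af + a *m b^T + b *m a^T + fx *: Ag
          - (gx *: Hf + u *m v^T + v *m u^T + fx *: Hg))
  <= ef * `|gx| + eg * `|fx| + 2 * (c *
    Num.min (eu * ev * c + ev * enorm u + eu * enorm v)
   (Num.min (eu * enorm b + ev * enorm u) (ev * enorm a + eu * enorm v))).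
Proof.
move=> c0 hf hg au bv.
have -> : gx *: Af + a *m b^T + b *m a^T + fx *: Ag
          - (gx *: Hf + u *m v^T + v *m u^T + fx *: Hg)
  = gx *: (Af - Hf) + fx *: (Ag - Hg)
    + ((a *m b^T - u *m v^T) + (b *m a^T - v *m u^T)).
  by apply/matrixP => i j; rewrite !mxE; ring.
apply: le_trans (opnormD _ _) _.
apply: le_trans (lerD (opnormD _ _) (opnormD _ _)) _.
set M := Num.min _ (Num.min _ _).
have h1 : opnorm (a *m b^T - u *m v^T) <= c * M by exact: outer_error.
have h2 : opnorm (b *m a^T - v *m u^T) <= c * M.
  have := outer_error c0 bv au; rewrite [X in Num.min _ X]minC.
  by rewrite (mulrC ev eu) [_ + eu * enorm v + _]addrAC.
have h3 : opnorm (a *m b^T - u *m v^T) + opnorm (b *m a^T - v *m u^T)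
    <= 2 * (c * M) by rewrite mulr_natl mulr2n (lerD h1 h2).
rewrite lerD// lerD//.
- by apply: le_trans (opnormZ _ _) _; rewrite mulrC ler_wpM2r.
- by apply: le_trans (opnormZ _ _) _; rewrite mulrC ler_wpM2r.
Qed.

End ProductErrors.

(** * The Hessian of a product *)

Section ProductRule.
Context {R : realType} {n : nat}.
Implicit Types (h f g : 'cV[R]_n -> R).

(** The topology is that of the max norm, so balls for [enorm] have to be
    compared with max-norm balls. *)
Lemma nbhs_eball (x0 : 'cV[R]_n) (D : R) : 0 < D -> nbhs x0 (eball x0 D).
Proof.
move=> D0; pose e := D / (Num.sqrt n%:R + 1).
have s0 : 0 < Num.sqrt n%:R + 1 :> R by rewrite ltr_wpDl ?sqrtr_ge0.
have e0 : 0 < e by rewrite divr_gt0.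
apply/nbhs_ballP; exists e => //= y xy; rewrite /eball/=.
have h : enorm (y - x0) <= Num.sqrt n%:R * e.
  apply: enorm_bound => [|i]; first exact: ltW.
  have := xy.2 i 0; rewrite /ball/= distrC => /ltW.
  by rewrite !mxE.
apply: le_lt_trans h _; rewrite /e mulrCA gtr_pMr//.
by rewrite ltr_pdivrMr// mul1r ltrDl.
Qed.

Lemma Ck_onW r U h : Ck_on r.+1 U h -> Ck_on r U h.
Proof.
elim: r h => [|r IH] h [ch dh]; first by split.
by split=> // i; have [di Ci] := dh i; split=> //; exact: IH.
Qed.

Lemma gradE h x i : grad h x i 0 = partial i h x.
Proof. by rewrite mxE. Qed.

Lemma hessE h x i j : hess h x i j = partial j (partial i h) x.
Proof. by rewrite mxE. Qed.

Lemma product_entryE (A B : 'M[R]_n) (u v : 'cV[R]_n) (a b : R) i j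
    Aij Bij ui uj vi vj :
  A i j = Aij -> B i j = Bij -> u i 0 = ui -> u j 0 = uj -> v i 0 = vi ->
  v j 0 = vj ->
  (a *: A + u *m v^T + v *m u^T + b *: B) i j
  = a * Aij + ui * vj + vi * uj + b * Bij.
Proof. by move=> <- <- <- <- <- <-; rewrite !mxE !big_ord1 !mxE. Qed.

Lemma hess_product f g (x0 : 'cV[R]_n) (D : R) : 0 < D ->
  Ck_on 2 (eball x0 D) f -> Ck_on 2 (eball x0 D) g ->
  hess (fun x => f x * g x) x0 =
  g x0 *: hess f x0 + grad f x0 *m (grad g x0)^T
  + grad g x0 *m (grad f x0)^T + f x0 *: hess g x0.
Proof.
move=> D0 [_ fC] [_ gC]; apply/matrixP => i j.
have Ux0 : eball x0 D x0 by rewrite /eball/= subrr enorm0.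
have [fi [_ fij]] := fC i; have [gi [_ gij]] := gC i.
have fg : (fun x => f x * g x) = f * g by [].
have e : \forall x \near x0, partial i (fun x => f x * g x) x
    = (f * partial i g + g * partial i f) x.
  near=> x; rewrite fg /partial deriveM//.
    by apply: fi; near: x; exact: nbhs_eball.
  by apply: gi; near: x; exact: nbhs_eball.
have dfj := derivableP ((fC j).1 _ Ux0).
have dgj := derivableP ((gC j).1 _ Ux0).
have dfij := derivableP ((fij j).1 _ Ux0).
have dgij := derivableP ((gij j).1 _ Ux0).
have d := is_deriveD (is_deriveM dfj dgij) (is_deriveM dgj dfij).
have alg (a b c p q r s t : R) :
    a * p + q * r + (b * s + t * c) = b * s + t * c + q * r + a * p by ring.
have dE := etrans (hessE _ x0 i j)
  (etrans (near_eq_derive _ e) (@derive_val _ _ _ _ _ _ _ d)).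
apply: (etrans dE); apply: (etrans (alg _ _ _ _ _ _ _ _)); apply: esym.
exact: (product_entryE _ _ (hessE f x0 i j) (hessE g x0 i j)
  (gradE f x0 i) (gradE f x0 j) (gradE g x0 i) (gradE g x0 j)).
Unshelve. all: by end_near. Qed.

End ProductRule.

(** * Errors of the simplex gradient and of the nested-set Hessian *)

Section SimplexErrors.
Context {R : realType} {n : nat}.
Implicit Types (h : 'cV[R]_n -> R).

Lemma mxBE p q (A B : 'M[R]_(p, q)) i j : (A - B) i j = A i j - B i j.
Proof. by rewrite !mxE. Qed.

Lemma dir_radius_ge m (S : 'M[R]_(n, m)) i : enorm (col i S) <= dir_radius S.
Proof. exact: le_bigmax. Qed.

Lemma dir_radius_ge0 m (S : 'M[R]_(n, m)) : 0 <= dir_radius S.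
Proof. exact: bigmax_ge_id. Qed.

Lemma dir_radius_gt0 m (S : 'M[R]_(n, m)) (i : 'I_n) :
  row_free S -> 0 < dir_radius S.
Proof.
move=> Sf; rewrite lt0r dir_radius_ge0 andbT; apply/eqP => S0.
suff S00 : S = 0.
  move: Sf; rewrite /row_free S00 mxrank0 => /eqP n0.
  by have := leq_ltn_trans (leq0n i) (ltn_ord i); rewrite -n0.
apply/matrixP => a j; rewrite !mxE.
have : enorm (col j S) = 0.
  by apply/eqP; rewrite eq_le enorm_ge0 andbT -S0 dir_radius_ge.
by move/enorm_eq0/colP/(_ a); rewrite !mxE.
Qed.

Lemma opnorm_mpinv_hat m (S : 'M[R]_(n, m)) : 0 < dir_radius S ->
  opnorm (mpinv S) <= opnorm (mpinv (mxhat S)) / dir_radius S.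
Proof.
move=> S0; have Sn0 := lt0r_neq0 S0.
have -> : mpinv S = (dir_radius S)^-1 *: mpinv (mxhat S).
  by rewrite /mxhat mpinvZ ?invr_eq0// invrK scalerA mulVf// scale1r.
apply: le_trans (opnormZ _ _) _.
by rewrite ger0_norm ?invr_ge0 ?dir_radius_ge0// mulrC.
Qed.

Lemma opnorm_mpinv_hat_tr m (S : 'M[R]_(n, m)) : 0 < dir_radius S ->
  opnorm (mpinv S^T) <= opnorm (mpinv (mxhat S)^T) / dir_radius S.
Proof.
move=> S0; have Sn0 := lt0r_neq0 S0.
have -> : mpinv S^T = (dir_radius S)^-1 *: mpinv (mxhat S)^T.
  rewrite /mxhat linearZ/= mpinvZ ?invr_eq0//.
  by rewrite invrK scalerA mulVf// scale1r.
apply: le_trans (opnormZ _ _) _.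
by rewrite ger0_norm ?invr_ge0 ?dir_radius_ge0// mulrC.
Qed.

Lemma mpinv_tr_mul m (S : 'M[R]_(n, m)) : row_free S ->
  mpinv S^T *m S^T = 1%:M.
Proof. by move=> Sf; rewrite mpinv_tr -trmx_mul mulmx_mpinv// trmx1. Qed.

Lemma sgrad_error k h (x0 : 'cV[R]_n) (T : 'M[R]_(n, k)) (D L : R) :
  row_free T -> 0 < dir_radius T -> dir_radius T < D -> 0 <= L ->
  lipschitz_partials x0 D h L -> grad_lipschitz_on (eball x0 D) h L ->
  enorm (sgrad h x0 T - grad h x0) <= E_sgrad T L * dir_radius T.
Proof.
move=> Tf T0 TD L0 lip glip.
rewrite -[grad h x0]mul1mx -(mpinv_tr_mul Tf) -mulmxA /sgrad -mulmxBr.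
apply: le_trans (enorm_mulmx _ _) _.
have r : enorm (\col_j (h (x0 + col j T) - h x0) - T^T *m grad h x0)
    <= Num.sqrt k%:R * (L / 2 * dir_radius T ^+ 2).
  apply: enorm_bound => [|j].
    by rewrite mulr_ge0 ?exprn_ge0 ?divr_ge0 ?dir_radius_ge0.
  have -> : (\col_j (h (x0 + col j T) - h x0) - T^T *m grad h x0) j 0
      = h (x0 + col j T) - h x0 - dot (grad h x0) (col j T).
    rewrite mxBE [X in X - _]mxE; congr (_ - _); rewrite dotC dotE mxE.
    by apply: eq_bigr => i _; rewrite [_^T _ _]mxE [col _ _ _ _]mxE.
  have jD := le_lt_trans (dir_radius_ge T j) TD.
  apply: le_trans (taylor1 L0 lip glip jD) _.
  rewrite ler_wpM2l ?divr_ge0// ler_pXn2r ?nnegrE ?enorm_ge0 ?dir_radius_ge0//.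
  exact: dir_radius_ge.
apply: le_trans
  (ler_pM (opnorm_ge0 _) (enorm_ge0 _) (opnorm_mpinv_hat_tr T0) r) _.
rewrite /E_sgrad le_eqVlt; apply/orP; left; apply/eqP; field.
exact: lt0r_neq0.
Qed.

(** Subtracting simplex gradients at x0 + s^i and x0 subtracts the vectors of
    differences of h, whence the mixed second differences. *)
Lemma shess_factor m k h (x0 : 'cV[R]_n) (S : 'M[R]_(n, m)) (T : 'M[R]_(n, k)) :
  shess h x0 S T = mpinv S^T *m (\matrix_(i, j)
    (h (x0 + col i S + col j T) - h (x0 + col i S)
     - (h (x0 + col j T) - h x0))) *m mpinv T.
Proof.
rewrite /shess -mulmxA; congr (_ *m _); apply/matrixP => i j.
rewrite mxE /sgrad -mulmxBr mpinv_tr !mxE.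
by apply: eq_bigr => l _; rewrite !mxE mulrC.
Qed.

(** Common factors apart, the estimates give sqrt(m) (Delta_S + Delta_T) / 2
    where the claim has m (2 Delta_u / Delta_l + 3) / 3 times Delta_u; the
    latter is larger as m >= 1 and Delta_u >= Delta_l. *)
Lemma shess_error m k h (x0 : 'cV[R]_n) (S : 'M[R]_(n, m))
    (T : 'M[R]_(n, k)) (D L1 L : R) :
  (0 < m)%N -> row_free S -> row_free T ->
  0 < dir_radius S -> 0 < dir_radius T -> dir_radius S + dir_radius T < D ->
  0 <= L1 -> 0 <= L -> lipschitz_partials x0 D h L1 ->
  (forall i, lipschitz_partials x0 D (partial i h) L) ->
  hess_lipschitz_on (eball x0 D) h L ->
  opnorm (shess h x0 S T - hess h x0) <= E_shess S T L * dir_radius_max S T.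
Proof.
move=> m0 Sf Tf S0 T0 STD L10 L0 lip1 lip2 hlip.
set Mx := (\matrix_(i, j)
    (h (x0 + col i S + col j T) - h (x0 + col i S)
     - (h (x0 + col j T) - h x0)) : 'M[R]_(m, k)).
have -> : shess h x0 S T - hess h x0
    = mpinv S^T *m (Mx - S^T *m hess h x0 *m T) *m mpinv T.
  rewrite shess_factor mulmxBr mulmxBl; congr (_ - _).
  by rewrite !mulmxA mpinv_tr_mul// mul1mx -mulmxA mulmx_mpinv// mulmx1.
set s := dir_radius S; set t := dir_radius T.
have Mb : opnorm (Mx - S^T *m hess h x0 *m T)
    <= Num.sqrt m%:R * Num.sqrt k%:R * (L * (s * t) * ((s + t) / 2)).
  apply: opnorm_bound => [|i j].
    by rewrite !mulr_ge0 ?addr_ge0 ?dir_radius_ge0 ?invr_ge0.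
  have -> : (Mx - S^T *m hess h x0 *m T) i j
    = h (x0 + col i S + col j T) - h (x0 + col i S) - (h (x0 + col j T) - h x0)
      - dot (col i S) (hess h x0 *m col j T).
    rewrite mxBE [X in X - _]mxE; congr (_ - _).
    by rewrite /dot tr_col -row_mul [RHS]mxE (colE j) !mulmxA -colE [RHS]mxE.
  have si := dir_radius_ge S i; have tj := dir_radius_ge T j.
  have ijD := le_lt_trans (lerD si tj) STD.
  apply: le_trans (mixed_difference L10 L0 lip1 lip2 hlip ijD) _.
  rewrite ler_pM ?mulr_ge0 ?addr_ge0 ?divr_ge0 ?addr_ge0 ?enorm_ge0//.
    by rewrite ler_wpM2l// ler_pM ?enorm_ge0.
  by rewrite ler_wpM2r// lerD.
apply: le_trans (opnormM _ _) _.
apply: le_trans (ler_wpM2r (opnorm_ge0 _) (opnormM _ _)) _.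
set a := opnorm (mpinv (mxhat S)^T); set b := opnorm (mpinv (mxhat T)).
have h1 : opnorm (mpinv S^T) * opnorm (Mx - S^T *m hess h x0 *m T)
    * opnorm (mpinv T)
  <= a / s * (Num.sqrt m%:R * Num.sqrt k%:R * (L * (s * t) * ((s + t) / 2)))
     * (b / t).
  rewrite ler_pM ?mulr_ge0 ?opnorm_ge0//; last exact: opnorm_mpinv_hat.
  by rewrite ler_pM ?opnorm_ge0//; exact: opnorm_mpinv_hat_tr.
apply: le_trans h1 _.
have s0 : s != 0 by exact: lt0r_neq0.
have t0 : t != 0 by exact: lt0r_neq0.
have -> : a / s
     * (Num.sqrt m%:R * Num.sqrt k%:R * (L * (s * t) * ((s + t) / 2)))
     * (b / t)
  = (Num.sqrt k%:R * L * a * b) * (Num.sqrt m%:R * ((s + t) / 2)).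
  by field; rewrite s0 t0.
rewrite /E_shess -/a -/b; set r := _ / dir_radius_min S T.
have -> : m%:R * Num.sqrt k%:R / 3 * L * (2 * r + 3) * a * b
    * dir_radius_max S T
  = (Num.sqrt k%:R * L * a * b)
    * (m%:R * ((2 * r + 3) / 3 * dir_radius_max S T)) by field.
rewrite ler_wpM2l ?mulr_ge0 ?sqrtr_ge0 ?opnorm_ge0//.
have r1 : 1 <= r.
  rewrite /r ler_pdivlMr ?mul1r; last by rewrite /dir_radius_min lt_min S0.
  by rewrite /dir_radius_min /dir_radius_max ge_min le_max lexx.
have st : (s + t) / 2 <= dir_radius_max S T.
  have : s <= dir_radius_max S T by rewrite le_max lexx.
  have : t <= dir_radius_max S T by rewrite le_max lexx orbT.
  by lra.
have sm : Num.sqrt m%:R <= m%:R :> R.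
  rewrite -[leRHS]ger0_norm ?ler0n// -sqrtr_sqr ler_wsqrtr// -natrX ler_nat.
  by rewrite -[leqLHS]expn1 leq_pexp2l.
have st0 : 0 <= (s + t) / 2 by rewrite divr_ge0 ?addr_ge0 ?dir_radius_ge0.
rewrite ler_pM ?sqrtr_ge0//; apply: (le_trans st).
by rewrite (ler_peMl (le_trans st0 st))//; lra.
Qed.

(** Moving from x0 + s^i by Delta_T further in the direction of s^i, or in any
    direction if s^i = 0, stays in the closed ball, hence in the open one. *)
Lemma radius_sum_lt m k (x0 : 'cV[R]_n) (S : 'M[R]_(n, m))
    (T : 'M[R]_(n, k)) (D : R) (i0 : 'I_n) (j0 : 'I_m) :
  (forall i, eclosed_ball (x0 + col i S) (dir_radius T) `<=` eball x0 D) ->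
  dir_radius S + dir_radius T < D.
Proof.
move=> ST; set t := dir_radius T; have t0 : 0 <= t := dir_radius_ge0 T.
have sD i : enorm (col i S) + t < D.
  set s := col i S; have [/enorm_eq0 s0|s0] := eqVneq (enorm s) 0.
    have := ST i (x0 + s + t *: delta_mx i0 0).
    rewrite /eclosed_ball /eball/= -/s s0 addr0 addrKB enormZ enorm_delta mulr1.
    by rewrite ger0_norm// enorm0 add0r; apply.
  have sp : 0 < enorm s by rewrite lt0r s0 enorm_ge0.
  have := ST i (x0 + s + (t / enorm s) *: s).
  rewrite /eclosed_ball /eball/= -/s addrKB -(addrA x0 s) addrKB.
  have -> : s + (t / enorm s) *: s = (1 + t / enorm s) *: s.
    by rewrite scalerDl scale1r.
  rewrite !enormZ.
  rewrite !ger0_norm ?addr_ge0 ?divr_ge0 ?enorm_ge0//.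
  by rewrite mulrDl mul1r divfK//; apply.
rewrite -ltrBrDr; apply: bigmax_lt => [|i _]; last by rewrite ltrBrDr.
by rewrite subr_gt0; apply: le_lt_trans (sD j0); rewrite lerDr enorm_ge0.
Qed.

End SimplexErrors.

(** * Quadratic polynomials in the monomial basis *)

Section QuadraticCoordinates.
Context {R : realType} {n : nat}.
Implicit Types (u z : 'cV[R]_n) (H : 'M[R]_n).

(** [inl a] stands for z_a and [inr (a, b)], with a <= b, for the quadratic
    monomial in z_a and z_b; the order is that of [quad_row]. *)
Definition monomials : seq ('I_n + 'I_n * 'I_n) :=
  [seq inl a | a <- enum 'I_n] ++ [seq inr (a, a) | a <- enum 'I_n] ++
  [seq inr (a, b) | a : 'I_n <- enum 'I_n,
                    b : 'I_n <- [seq b : 'I_n <- enum 'I_n | (a < b)%N]].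

Definition mono_eval z (x : 'I_n + 'I_n * 'I_n) : R :=
  match x with
  | inl a => z a 0
  | inr (a, b) => if a == b then 2^-1 * z a 0 ^+ 2 else z a 0 * z b 0
  end.

Definition mono_coef u H (x : 'I_n + 'I_n * 'I_n) : R :=
  match x with inl a => u a 0 | inr (a, b) => H a b end.

(** Coordinates of the quadratic z |-> u . z + z^T H z / 2 in the basis of
    [monomials]; see [mulmx_Qhat]. *)
Definition coef_vec u H : 'cV[R]_(quad_p n) :=
  \col_j nth 0 [seq mono_coef u H x | x <- monomials] j.

Definition quad_form u H z : R := dot u z + 2^-1 * dot z (H *m z).

Lemma quad_row_monomials z : quad_row z = [seq mono_eval z x | x <- monomials].
Proof.
rewrite /quad_row /monomials !map_cat -!map_comp map_allpairs.
congr (_ ++ (_ ++ _)).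
  by apply: eq_map => a /=; rewrite eqxx.
congr flatten; apply: eq_map => a; apply/eq_in_map => b.
by rewrite mem_filter /= => /andP[ab _]; rewrite -val_eqE/= ltn_eqF.
Qed.

Lemma size_monomials : size monomials = quad_p n.
Proof.
by rewrite -(size_quad_row (0 : 'cV[R]_n)) quad_row_monomials size_map.
Qed.

Lemma sum_nth_monomials (F G : 'I_n + 'I_n * 'I_n -> R) :
  \sum_(j < quad_p n) nth 0 (map F monomials) j * nth 0 (map G monomials) j
  = \sum_(x <- monomials) F x * G x.
Proof.
rewrite -size_monomials; elim: monomials => [|x s IH].
  by rewrite big_ord0 big_nil.
by rewrite big_ord_recl big_cons /= IH.
Qed.

Lemma sum_monomials (F : 'I_n + 'I_n * 'I_n -> R) :
  \sum_(x <- monomials) F x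
  = \sum_(a < n) F (inl a) + (\sum_(a < n) F (inr (a, a))
    + \sum_(a < n) \sum_(b : 'I_n | (a < b)%N) F (inr (a, b))).
Proof.
rewrite /monomials !big_cat !big_map big_allpairs_dep !big_enum.
congr (_ + (_ + _)).
by apply: eq_bigr => a _; rewrite big_filter big_enum_cond.
Qed.

(** For symmetric H the pairs a < b account for both H a b and H b a, which
    cancels the factor 1/2; on the diagonal this factor is in the monomial. *)
Lemma quad_form_monomials u H z : H^T = H ->
  \sum_(x <- monomials) mono_eval z x * mono_coef u H x = quad_form u H z.
Proof.
move=> Hs; rewrite sum_monomials /quad_form /=; congr (_ + _).
  by rewrite dotC dotE.
have He a b : H a b = H b a by rewrite -{1}Hs mxE.
have -> : dot z (H *m z) = \sum_(a < n) \sum_(b < n) z a 0 * H a b * z b 0.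
  rewrite dotE; apply: eq_bigr => a _; rewrite mxE mulr_sumr.
  by apply: eq_bigr => b _; rewrite mulrA.
pose U := \sum_(a < n) \sum_(b : 'I_n | (a < b)%N) z a 0 * H a b * z b 0.
have -> : \sum_(a < n) \sum_(b < n) z a 0 * H a b * z b 0
    = \sum_(a < n) z a 0 * H a a * z a 0 + (U + U).
  transitivity (\sum_(a < n) (z a 0 * H a a * z a 0
      + (\sum_(b : 'I_n | (a < b)%N) z a 0 * H a b * z b 0
         + \sum_(b : 'I_n | (b < a)%N) z a 0 * H a b * z b 0))).
    apply: eq_bigr => a _; rewrite (bigD1 a)//=; congr (_ + _).
    rewrite (bigID (fun b : 'I_n => (a < b)%N))/=; congr (_ + _).
      apply: eq_bigl => b; rewrite -val_eqE/=.
      by case: ltngtP.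
    apply: eq_bigl => b; rewrite -val_eqE/=.
    by case: ltngtP.
  rewrite big_split/= big_split/=; congr (_ + (_ + _)).
  rewrite (exchange_big_dep xpredT)//=; apply: eq_bigr => a _.
  by apply: eq_bigr => b _; rewrite He; ring.
rewrite mulrDr -[U + U]mulr2n -[U *+ 2]mulr_natl mulrA mulVf ?mul1r//.
congr (_ + _).
  rewrite mulr_sumr; apply: eq_bigr => a _; rewrite eqxx; ring.
apply: eq_bigr => a _; apply: eq_bigr => b ab.
by rewrite -val_eqE/= ltn_eqF//; ring.
Qed.

Lemma coef_vec_dot u v H K :
  dot (coef_vec u H) (coef_vec v K)
  = \sum_(x <- monomials) mono_coef u H x * mono_coef v K x.
Proof.
rewrite dotE -sum_nth_monomials.
by apply: eq_bigr => j _; rewrite /coef_vec !mxE.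
Qed.

Lemma coef_vec0 : coef_vec 0 0 = 0.
Proof.
apply: enorm_eq0; apply/eqP; rewrite -sqrf_eq0 enormE coef_vec_dot big1//.
by move=> [a|[a b]] _; rewrite /= mxE mul0r.
Qed.

(** The entries of u are the first n entries of the coefficient vector. *)
Lemma enorm_coef_vec u H : enorm u <= enorm (coef_vec u H).
Proof.
apply: enorm_le; rewrite ?enorm_ge0// enormE coef_vec_dot sum_monomials dotE/=.
rewrite lerDl addr_ge0// sumr_ge0// => a _; last apply: sumr_ge0 => b _.
  by rewrite -expr2 sqr_ge0.
by rewrite -expr2 sqr_ge0.
Qed.

Lemma uniq_monomials : uniq monomials.
Proof.
have inl_inj : injective (inl : 'I_n -> 'I_n + 'I_n * 'I_n) by move=> a b [].
have diag_inj : injective (fun a => inr (a, a) : 'I_n + 'I_n * 'I_n).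
  by move=> a b [].
rewrite /monomials !cat_uniq (map_inj_uniq inl_inj) (map_inj_uniq diag_inj).
rewrite enum_uniq !andTb; apply/and3P; split.
- apply/hasPn => x xin; apply/negP => /mapP[a _ xa]; move: xin.
  rewrite xa mem_cat.
  by move=> /orP[/mapP[]|/allpairsPdep[? [? []]]].
- apply/hasPn => x xin; apply/negP => /mapP[a _ xa]; move: xin; rewrite xa.
  move=> /allpairsPdep[b [c [_]]]; rewrite mem_filter => /andP[bc _] [-> e].
  by move: bc; rewrite -e ltnn.
- apply: allpairs_uniq_dep; first exact: enum_uniq.
    by move=> a _; rewrite filter_uniq ?enum_uniq.
  by move=> [a b] [c d] _ _ /= [-> ->].
Qed.

(** As [monomials] has no repetition, an entry of v can be looked up at the
    position of its monomial. *)
Lemma coef_vec_surj (v : 'cV[R]_(quad_p n)) :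
  exists u H, H^T = H /\ v = coef_vec u H.
Proof.
pose phi x : R := if insub (index x monomials) is Some j then v j 0 else 0.
pose u : 'cV[R]_n := \col_a phi (inl a).
pose H : 'M[R]_n :=
  \matrix_(a, b) phi (inr (if (a <= b)%N then (a, b) else (b, a))).
have cphi x : x \in monomials -> mono_coef u H x = phi x.
  rewrite !mem_cat => /or3P[/mapP[a _ ->]|/mapP[a _ ->]|/allpairsPdep].
  - by rewrite /= mxE.
  - by rewrite /= mxE leqnn.
  - move=> [a [b [_]]]; rewrite mem_filter => /andP[ab _] ->.
    by rewrite /= mxE ltnW.
exists u, H; split.
  apply/matrixP => a b; rewrite !mxE; congr (phi (inr _)).
  by case: (ltngtP a b) => // /val_inj ->.
apply/colP => j; rewrite mxE.
have js : (j < size monomials)%N by rewrite size_monomials.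
have [x0 _] : exists x, x \in monomials.
  by case: monomials js => // x s _; exists x; rewrite mem_head.
rewrite (nth_map x0)// cphi ?mem_nth// /phi index_uniq ?uniq_monomials//.
by rewrite (valK j).
Qed.

Lemma mulmx_Qhat (y : 'I_(quad_p n).+1 -> 'cV[R]_n) d u H i : H^T = H ->
  (Qhat y d *m coef_vec u H) i 0
  = quad_form u H (d^-1 *: (y (lift ord0 i) - y ord0)).
Proof.
move=> Hs; rewrite -quad_form_monomials// -sum_nth_monomials mxE.
by apply: eq_bigr => j _; rewrite !mxE quad_row_monomials.
Qed.

Lemma quad_formZ (c : R) u H z :
  quad_form (c *: u) (c ^+ 2 *: H) z = quad_form u H (c *: z).
Proof.
rewrite /quad_form dotZl -scalemxAr -scalemxAl !dotZr dotZl.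
by rewrite expr2 !mulrA.
Qed.

Lemma quad_formB u v H K z :
  quad_form (u - v) (H - K) z = quad_form u H z - quad_form v K z.
Proof. by rewrite /quad_form dotBl mulmxBl dotBr; ring. Qed.

(** Passing to the symmetric part makes [mulmx_Qhat] applicable to a Taylor
    polynomial. *)
Lemma quad_form_sym u H z :
  quad_form u (2^-1 *: (H + H^T)) z = quad_form u H z.
Proof.
rewrite /quad_form; congr (_ + _ * _).
by rewrite -scalemxAl dotZr mulmxDl dotDr (dotC z (H^T *m z)) dot_trmx; lra.
Qed.

End QuadraticCoordinates.

(** * The gradient of the quadratic interpolant *)

Section QuadraticInterpolant.
Context {R : realType} {n : nat}.
Implicit Types (u z x d : 'cV[R]_n) (H : 'M[R]_n) (q : R * 'cV[R]_n * 'M[R]_n).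

Lemma quad_evalE q x : quad_eval q x = q.1.1 + quad_form q.1.2 q.2 x.
Proof. by rewrite /quad_eval /quad_form /dot mulmxA addrA. Qed.

Lemma quad_evalD q x d : q.2^T = q.2 ->
  quad_eval q (x + d) = quad_eval q x + quad_form (q.1.2 + q.2 *m x) q.2 d.
Proof.
move=> qs; rewrite !quad_evalE /quad_form mulmxDr !dotDl !dotDr.
rewrite (dot_mxsym x d qs) (dotC (q.2 *m x)); lra.
Qed.

(** [quad_eval] is expanded at the origin; this is the same quadratic given by
    its expansion at x. *)
Definition quad_centered (x : 'cV[R]_n) (c : R) u H :
    R * 'cV[R]_n * 'M[R]_n :=
  (c - dot u x + 2^-1 * dot x (H *m x), u - H *m x, H).

Lemma quad_eval_centered x c u H z : H^T = H ->
  quad_eval (quad_centered x c u H) z = c + quad_form u H (z - x).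
Proof.
move=> Hs; have -> : z = x + (z - x) by rewrite addrC subrK.
rewrite quad_evalD// addrKB /= subrK; congr (_ + _).
rewrite quad_evalE /quad_form /= dotBl (dotC (H *m x)); lra.
Qed.

Lemma grad_quad_eval q x : q.2^T = q.2 ->
  grad (quad_eval q) x = q.1.2 + q.2 *m x.
Proof.
move=> qs; apply/colP => i; rewrite mxE.
suff d : is_derive x (delta_mx i 0) (quad_eval q) ((q.1.2 + q.2 *m x) i 0).
  exact: (@derive_val _ _ _ _ _ _ _ d).
apply: (@is_derive_quadratic _ _ _ _ _ _
  `|2^-1 * dot (delta_mx i 0) (q.2 *m delta_mx i 0)| 1) => // e _.
rewrite quad_evalD// /quad_form dotZr -scalemxAr dotZr dotZl.
have -> : dot (q.1.2 + q.2 *m x) (delta_mx i 0) = (q.1.2 + q.2 *m x) i 0.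
  rewrite dotE (bigD1 i)//= big1 ?addr0 => [|j ji].
    by rewrite [delta_mx _ _ _ _]mxE !eqxx mulr1.
  by rewrite [delta_mx _ _ _ _]mxE (negbTE ji) mulr0.
set a := _ i 0; set b := dot _ _.
rewrite -[e ^+ 2]ger0_norm ?sqr_ge0// -normrM le_eqVlt; apply/orP; left.
by apply/eqP; congr `| _ |; ring.
Qed.

Section PoisedSet.
Variables (Y : set 'cV[R]_n) (y : 'I_(quad_p n).+1 -> 'cV[R]_n) (r : R).
Hypotheses (Yp : poised Y) (yY : range y = Y) (r0 : r != 0).

(** The uniqueness clause of poisedness, for quadratics centred at y^0 and
    vanishing there. *)
Lemma poised_quad_form_eq0 u H : H^T = H ->
  (forall i, quad_form u H (y i - y ord0) = 0) -> u = 0 /\ H = 0.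
Proof.
move=> Hs uH0; have [_ [q [_ q_uniq]]] := Yp.
have e0 : q = (0, 0, 0).
  apply: q_uniq; split => [|z _]; first by rewrite /= trmx0.
  by rewrite quad_evalE /quad_form /= mul0mx dot0r dotC dot0r mulr0 !addr0.
have : q = quad_centered (y ord0) 0 u H.
  apply: q_uniq; split => // z; rewrite -yY => -[i _ <-].
  by rewrite quad_eval_centered// uH0 addr0.
rewrite e0 => -[_ /esym/eqP]; rewrite subr_eq0 => /eqP uE HE.
by rewrite -HE mul0mx in uE.
Qed.

(** A kernel vector is the coefficient vector of a quadratic vanishing on the
    sample set, after undoing the scaling by r. *)
Lemma Qhat_unit : Qhat y r \in unitmx.
Proof.
rewrite -unitmx_tr -row_free_unit -kermx_eq0; apply/rowV0P => v.
move=> /sub_kermxP vQ; apply: trmx_inj; rewrite trmx0.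
have [u [H [Hs vE]]] := coef_vec_surj v^T.
have Q0 : Qhat y r *m coef_vec u H = 0.
  by rewrite -vE -[Qhat y r]trmxK -trmx_mul vQ trmx0.
suff [u0 H0] : r^-1 *: u = 0 /\ r^-1 ^+ 2 *: H = 0.
  move/eqP: u0; rewrite scaler_eq0 invr_eq0 (negbTE r0)/= => /eqP uE.
  move/eqP: H0; rewrite scaler_eq0 sqrf_eq0 invr_eq0 (negbTE r0)/= => /eqP HE.
  by rewrite vE uE HE coef_vec0.
apply: poised_quad_form_eq0 => [|i]; first by rewrite linearZ/= Hs.
rewrite quad_formZ; case: (unliftP ord0 i) => [j|] ->.
  by rewrite -mulmx_Qhat// Q0 mxE.
by rewrite subrr scaler0 /quad_form mulmx0 !dot0r mulr0 addr0.
Qed.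

Lemma quad_interp_exists (h : 'cV[R]_n -> R) :
  exists q, quad_interpolates Y h q.
Proof.
pose w := \col_j (h (y (lift ord0 j)) - h (y ord0)).
have [u [H [Hs wE]]] := coef_vec_surj (invmx (Qhat y r) *m w).
exists (quad_centered (y ord0) (h (y ord0)) (r^-1 *: u) (r^-1 ^+ 2 *: H)).
have Hs' : (r^-1 ^+ 2 *: H)^T = r^-1 ^+ 2 *: H by rewrite linearZ/= Hs.
split => // z; rewrite -yY => -[i _ <-].
rewrite quad_eval_centered// quad_formZ; case: (unliftP ord0 i) => [j|] ->.
  rewrite -mulmx_Qhat// -wE mulmxA mulmxV ?Qhat_unit// mul1mx mxE.
  by rewrite addrC subrK.
by rewrite subrr scaler0 /quad_form mulmx0 !dot0r mulr0 !addr0.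
Qed.

(** The interpolant minus the model d |-> h (y^0) + g . d + d^T K d / 2 is a
    quadratic vanishing at y^0, whose values at the other sample points are the
    errors of the model.  Qhat sends its coefficient vector to these values. *)
Lemma grad_interp_error (h : 'cV[R]_n -> R) (g : 'cV[R]_n) (K : 'M[R]_n)
    (eps : R) :
  0 <= eps -> 0 < r ->
  (forall i, `|h (y i) - h (y ord0) - quad_form g K (y i - y ord0)| <= eps) ->
  r * enorm (grad (quad_interp Y h) (y ord0) - g)
  <= opnorm (invmx (Qhat y r)) * (Num.sqrt (quad_p n)%:R * eps).
Proof.
move=> eps0 rp heps; rewrite /quad_interp.
set q := xget _ _; have [qs qh] : quad_interpolates Y h q.
  exact: (xgetPex _ (quad_interp_exists h)).
have yin i : Y (y i) by rewrite -yY; exists i.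
rewrite grad_quad_eval//; set u := _ - g.
pose H := q.2 - 2^-1 *: (K + K^T).
have Hs : H^T = H.
  by rewrite /H linearB/= linearZ/= linearD/= qs trmxK [K^T + _]addrC.
have uH i : quad_form u H (y i - y ord0)
    = h (y i) - h (y ord0) - quad_form g K (y i - y ord0).
  rewrite quad_formB quad_form_sym; congr (_ - _).
  rewrite -!qh//; have := quad_evalD (y ord0) (y i - y ord0) qs.
  by rewrite [y ord0 + _]addrC subrK => ->; rewrite addrKB.
set w := coef_vec (r *: u) (r ^+ 2 *: H).
have Hs' : (r ^+ 2 *: H)^T = r ^+ 2 *: H by rewrite linearZ/= Hs.
have -> : r * enorm u = enorm (r *: u) by rewrite enormZ gtr0_norm.
apply: le_trans (enorm_coef_vec _ (r ^+ 2 *: H)) _; rewrite -/w.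
have -> : w = invmx (Qhat y r) *m (Qhat y r *m w).
  by rewrite mulmxA mulVmx ?Qhat_unit// mul1mx.
apply: le_trans (enorm_mulmx _ _) _; rewrite ler_wpM2l ?opnorm_ge0//.
apply: enorm_bound => // i.
by rewrite mulmx_Qhat// quad_formZ scalerA mulfV// scale1r uH.
Qed.

End PoisedSet.

Lemma sample_set_radius m k (x0 : 'cV[R]_n) (S : 'M[R]_(n, m))
    (T : 'M[R]_(n, k)) z :
  sample_set x0 S T z -> enorm (z - x0) <= dir_radius S + dir_radius T.
Proof.
move=> [[[->|[i _ <-]]|[j _ <-]]|[i [j ->]]].
- by rewrite subrr enorm0 addr_ge0 ?dir_radius_ge0.
- by rewrite addrKB ler_wpDr ?dir_radius_ge0 ?dir_radius_ge.
- by rewrite addrKB ler_wpDl ?dir_radius_ge0 ?dir_radius_ge.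
- rewrite -(addrA x0) addrKB; apply: le_trans (enormD _ _) _.
  by rewrite lerD ?dir_radius_ge.
Qed.

(** The argument yields the constant sqrt(p) L |Qhat^-1| r^2 / 4 with
    r = Delta_S + Delta_T <= 2 Delta_u, so the factor 6 (1 + sqrt 2) >= 1 leaves
    room. *)
Lemma gradQ_error m k (h : 'cV[R]_n -> R) (x0 : 'cV[R]_n) (S : 'M[R]_(n, m))
    (T : 'M[R]_(n, k)) (y : 'I_(quad_p n).+1 -> 'cV[R]_n) (D L1 L : R) :
  0 < dir_radius S -> 0 < dir_radius T -> dir_radius S + dir_radius T < D ->
  0 <= L1 -> 0 <= L -> lipschitz_partials x0 D h L1 ->
  (forall i, lipschitz_partials x0 D (partial i h) L) ->
  hess_lipschitz_on (eball x0 D) h L ->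
  poised (sample_set x0 S T) -> y ord0 = x0 -> range y = sample_set x0 S T ->
  enorm (grad_Q h x0 S T - grad h x0)
  <= E_gradQ y S T L * dir_radius_max S T ^+ 2.
Proof.
move=> S0 T0 STD L10 L0 lip1 lip2 hlip Yp y0 yY.
set r := dir_radius S + dir_radius T.
have r0 : 0 < r by rewrite addr_gt0.
have remainder i : `|h (y i) - h (y ord0)
    - quad_form (grad h x0) (hess h x0) (y i - y ord0)| <= L / 4 * r ^+ 3.
  have yr : enorm (y i - x0) <= r.
    by apply: sample_set_radius; rewrite -yY; exists i.
  have := taylor2 L10 L0 lip1 lip2 hlip (le_lt_trans yr STD).
  rewrite [x0 + _]addrC subrK y0 opprD addrA => H; apply: (le_trans H).
  rewrite ler_wpM2l ?divr_ge0// ler_pXn2r ?nnegrE ?enorm_ge0//.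
  exact: ltW.
have e0 : 0 <= L / 4 * r ^+ 3 by rewrite mulr_ge0 ?divr_ge0 ?exprn_ge0// ltW.
have := grad_interp_error Yp yY (lt0r_neq0 r0) e0 r0 remainder.
rewrite y0 -/(grad_Q h x0 S T) /E_gradQ -/r.
set N := opnorm _; set s := Num.sqrt (quad_p n)%:R; set M := dir_radius_max S T.
move=> H.
have rM : r <= 2 * M.
  have : dir_radius S <= M by rewrite le_max lexx.
  have : dir_radius T <= M by rewrite le_max lexx orbT.
  by rewrite /r; lra.
have NsL : 0 <= N * s * L by rewrite !mulr_ge0 ?opnorm_ge0 ?sqrtr_ge0.
have H1 : enorm (grad_Q h x0 S T - grad h x0) <= N * s * L * (r ^+ 2 / 4).
  rewrite -(ler_pM2l r0); apply: (le_trans H).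
  by rewrite le_eqVlt; apply/orP; left; apply/eqP; field.
have rM2 : r ^+ 2 / 4 <= M ^+ 2.
  rewrite ler_pdivrMr// -[leRHS]mulrC -[4]/(2 * 2)%:R natrM -expr2 -exprMn.
  by rewrite ler_pXn2r// nnegrE ltW// (lt_le_trans r0 rM).
have c1 : 1 <= 6 * (1 + Num.sqrt 2) :> R.
  by have := sqrtr_ge0 (2 : R); lra.
apply: (le_trans H1); apply: (le_trans (ler_wpM2l NsL rM2)).
have -> : 6 * (1 + Num.sqrt 2) * s * L * N * M ^+ 2
  = (6 * (1 + Num.sqrt 2)) * (N * s * L * M ^+ 2) by ring.
by rewrite ler_peMl// mulr_ge0// sqr_ge0.
Qed.

End QuadraticInterpolant.

(** * The product of two functions *)

Section DegenerateDimension.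
Context {R : realType}.

Lemma opnorm_dim0 (A : 'M[R]_0) : opnorm A = 0.
Proof.
apply/eqP; rewrite eq_le opnorm_ge0 andbT; apply: opnorm_le => // x.
by rewrite (flatmx0 (A *m x)) enorm0 mul0r.
Qed.

Lemma dir_radius_dim0 m (S : 'M[R]_(0, m)) : dir_radius S = 0.
Proof.
apply/eqP; rewrite eq_le dir_radius_ge0 andbT; apply: bigmax_le => // i _.
by rewrite (flatmx0 (col i S)) enorm0.
Qed.

End DegenerateDimension.

Theorem proposition5p1 (R : realType) (n m k : nat) (f g : 'cV[R]_n -> R)
    (x0 : 'cV[R]_n) (Dbar : R) (S : 'M[R]_(n, m)) (T : 'M[R]_(n, k))
    (L1f L1g L2f L2g : R) :
  0 < Dbar ->
  Ck_on 3 (eball x0 Dbar) f ->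
  Ck_on 3 (eball x0 Dbar) g ->
  grad_lipschitz_on (eball x0 Dbar) f L1f ->
  grad_lipschitz_on (eball x0 Dbar) g L1g ->
  hess_lipschitz_on (eball x0 Dbar) f L2f ->
  hess_lipschitz_on (eball x0 Dbar) g L2g ->
  row_free S ->
  row_free T ->
  (forall i : 'I_m,
     eclosed_ball (x0 + col i S) (dir_radius T) `<=` eball x0 Dbar) ->
  let Du := dir_radius_max S T in
  let Hfg := hess (fun x => f x * g x) x0 in
  let EHf := E_shess S T L2f in
  let EHg := E_shess S T L2g in
  (let Ef := E_sgrad T L1f in
   let Eg := E_sgrad T L1g in
   let Ms :=
     Num.min (Ef * Eg * Du + Eg * enorm (grad f x0) + Ef * enorm (grad g x0))
    (Num.min (Ef * enorm (sgrad g x0 T) + Eg * enorm (grad f x0))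
             (Eg * enorm (sgrad f x0 T) + Ef * enorm (grad g x0))) in
   opnorm (hess_sc f g x0 S T - Hfg)
   <= (EHf * `|g x0| + EHg * `|f x0| + 2 * Ms) * Du)
  /\
  (poised (sample_set x0 S T) ->
   forall y : 'I_(quad_p n).+1 -> 'cV[R]_n,
   y ord0 = x0 -> injective y -> range y = sample_set x0 S T ->
   let Ef := E_gradQ y S T L2f in
   let Eg := E_gradQ y S T L2g in
   let Mq :=
     Num.min
       (Ef * Eg * Du ^+ 2 + Eg * enorm (grad f x0) + Ef * enorm (grad g x0))
    (Num.min (Ef * enorm (grad_Q g x0 S T) + Eg * enorm (grad f x0))
             (Eg * enorm (grad_Q f x0 S T) + Ef * enorm (grad g x0))) in
   opnorm (hess_qc f g x0 S T - Hfg)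
   <= (EHf * `|g x0| + EHg * `|f x0| + 2 * Mq * Du) * Du).
Proof.
move=> D0 fC gC f1 g1 f2 g2 Sf Tf ST Du Hfg EHf EHg.
have [n0|n0] := posnP n.
  (* In dimension 0 all radii and all norms vanish. *)
  subst n; have Du0 : Du = 0.
    by rewrite /Du /dir_radius_max !dir_radius_dim0 maxxx.
  by split=> [|*] /=; rewrite Du0 mulr0 opnorm_dim0.
pose i0 := Ordinal n0.
have m0 : (0 < m)%N.
  by apply: (leq_trans n0); have := rank_leq_col S; rewrite (eqP Sf).
have S0 := dir_radius_gt0 i0 Sf; have T0 := dir_radius_gt0 i0 Tf.
have STD := radius_sum_lt i0 (Ordinal m0) ST.
have TD : dir_radius T < Dbar by apply: le_lt_trans STD; rewrite lerDr ltW.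
have lip_ge0 h L : grad_lipschitz_on (eball x0 Dbar) h L -> 0 <= L.
  move=> hL; apply: (lipschitz_const_ge0 i0 (x0 := x0) D0) => x y Ux Uy.
  exact: le_trans (enorm_ge0 _) (hL _ _ Ux Uy).
have hess_lip_ge0 h L : hess_lipschitz_on (eball x0 Dbar) h L -> 0 <= L.
  move=> hL; apply: (lipschitz_const_ge0 i0 (x0 := x0) D0) => x y Ux Uy.
  exact: le_trans (opnorm_ge0 _) (hL _ _ Ux Uy).
have fl := Ck_lipschitz_partials fC f1; have gl := Ck_lipschitz_partials gC g1.
have fl2 i := Ck_lipschitz_second_partials i fC f2.
have gl2 i := Ck_lipschitz_second_partials i gC g2.
have Lf := lip_ge0 _ _ f1; have Lg := lip_ge0 _ _ g1.
have Lf2 := hess_lip_ge0 _ _ f2; have Lg2 := hess_lip_ge0 _ _ g2.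
have Du0 : 0 <= Du by rewrite le_max dir_radius_ge0.
have HfE := shess_error m0 Sf Tf S0 T0 STD Lf Lf2 fl fl2 f2.
have HgE := shess_error m0 Sf Tf S0 T0 STD Lg Lg2 gl gl2 g2.
have Hprod : Hfg = g x0 *: hess f x0 + grad f x0 *m (grad g x0)^T
    + grad g x0 *m (grad f x0)^T + f x0 *: hess g x0.
  exact: hess_product D0 (Ck_onW fC) (Ck_onW gC).
have sE h L : 0 <= L -> lipschitz_partials x0 Dbar h L ->
    grad_lipschitz_on (eball x0 Dbar) h L ->
    enorm (sgrad h x0 T - grad h x0) <= E_sgrad T L * Du.
  move=> L0 hl hL; apply: le_trans (sgrad_error Tf T0 TD L0 hl hL) _.
  rewrite ler_wpM2l ?le_max ?lexx ?orbT// /E_sgrad.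
  by rewrite !mulr_ge0 ?invr_ge0 ?sqrtr_ge0 ?opnorm_ge0.
rewrite Hprod; split.
- move=> Ef Eg Ms; rewrite /hess_sc.
  have P := product_error (f x0) (g x0) Du0 HfE HgE
    (sE _ _ Lf fl f1) (sE _ _ Lg gl g1).
  apply: (le_trans P); rewrite le_eqVlt; apply/orP; left; apply/eqP.
  by rewrite -/Du -/EHf -/EHg -/Ef -/Eg -/Ms; ring.
- move=> Yp y y0 _ yY; cbv zeta.
  have QfE := gradQ_error S0 T0 STD Lf Lf2 fl fl2 f2 Yp y0 yY.
  have QgE := gradQ_error S0 T0 STD Lg Lg2 gl gl2 g2 Yp y0 yY.
  rewrite /hess_qc.
  have P := product_error (f x0) (g x0) (exprn_ge0 2 Du0) HfE HgE QfE QgE.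
  apply: (le_trans P); rewrite le_eqVlt; apply/orP; left; apply/eqP.
  by rewrite -/Du -/EHf -/EHg; ring.
Qed.
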